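(* Let $\boldsymbol{n}=(n_1,\dots,n_r)$ and $\boldsymbol{d}=(d_1,\dots,d_r)$ be $r$-tuples of positive integers with $n_1\le\dots\le n_r$ and $d_1+\dots+d_r\ge3$. Let $SV^{\boldsymbol{n}}_{\boldsymbol{d}}\subset\mathbb{P}^N$ be the corresponding Segre-Veronese variety and let $p_0,\dots,p_{n_1}\in SV^{\boldsymbol{n}}_{\boldsymbol{d}}$ be general points. Assume that $d=d_1\le d_i-2$ for each $i\ne1$. Then a general hyperplane $H\subset\mathbb{P}^N$ containing $$T=\langle T^{d}_{p_0}SV^{\boldsymbol{n}}_{\boldsymbol{d}},\dots,T^{d}_{p_{n_1}}SV^{\boldsymbol{n}}_{\boldsymbol{d}}\rangle$$ is not tangent to $SV^{\boldsymbol{n}}_{\boldsymbol{d}}$ along a positive dimensional subvariety.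
   Context: We work over the complex numbers. **Segre-Veronese variety.** $SV^{\boldsymbol{n}}_{\boldsymbol{d}}\subset\mathbb{P}^{N}$, with $N=\prod_{i=1}^r\binom{n_i+d_i}{d_i}-1$, is the product $\mathbb{P}^{n_1}\times\dots\times\mathbb{P}^{n_r}$ embedded by the complete linear system $|\mathcal{O}_{\mathbb{P}^{n_1}\times\dots\times\mathbb{P}^{n_r}}(d_1,\dots,d_r)|$. **Osculating spaces.** Let $X\subset\mathbb{P}^N$ be a projective variety of dimension $n$, $p\in X$ a smooth point, and $\phi:\mathcal{U}\subseteq\mathbb{C}^n\to\mathbb{C}^N$ a local parametrization of $X$ near $p$ with $\phi(0)=p$. The $s$-osculating space $T^s_pX$ is the projective closure in $\mathbb{P}^N$ of the affine subspace of $\mathbb{C}^N$ through $p$ whose direction is generated by all partial derivatives of $\phi$ at $0$ of order at most $s$. A hyperplane $H$ is tangent to $X$ at a (smooth) point $x$ if $T_xX\subset H$. *)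

(* Defs.v *)
From HB Require Import structures.
From mathcomp Require Import all_boot all_order all_algebra.
From mathcomp Require Export complex.
From mathcomp.multinomials Require Export mpoly.
From mathcomp Require Import reals.

Set Implicit Arguments.
Unset Strict Implicit.
Unset Printing Implicit Defensive.

Import GRing.Theory.
Local Open Scope ring_scope.

(* Conventions.  A point of P^(m-1) is given by homogeneous coordinates, i.e.
   a nonzero row vector of size m; a k-tuple of points is a k x m matrix all of
   whose rows are nonzero.  A subset of (P^(m-1))^k is a Prop-valued predicate
   on such matrices which is invariant under rescaling each row.  A hyperplane
   of P^(m-1) is a point h of the dual projective space.  A linear subspace of
   P^(m-1) is given by its affine cone, a linear subspace of 'rV_m. *)

Section Projective.

Variable C : fieldType.

Section Zariski.

Variables k m : nat.
Implicit Types (f : {mpoly C[k * m]}) (p : 'M[C]_(k, m)).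
Implicit Types Z L P : 'M[C]_(k, m) -> Prop.

(* The k * m variables are the homogeneous coordinates on (P^(m-1))^k, ordered
   as in mxvec; for k = 1 this is ordinary homogeneity. *)
Definition multihomog (e : 'I_k -> nat) f : Prop :=
  forall u : 'X_{1..k * m}, u \in msupp f ->
  forall j : 'I_k, (\sum_(i < m) u (mxvec_index j i))%N = e j.

Definition mx_eval f p : C := f.@[fun a => mxvec p 0 a].

Definition zariski_closed Z : Prop :=
  exists S : {mpoly C[k * m]} -> Prop,
    (forall f, S f -> exists e, multihomog e f) /\
    (forall p, Z p <->
       (forall j, row j p != 0) /\ (forall f, S f -> mx_eval f p = 0)).

Definition irreducible_closed Z : Prop :=
  [/\ zariski_closed Z,
      exists p, Z p
    & forall A B, zariski_closed A -> zariski_closed B ->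
        (forall p, Z p -> A p \/ B p) ->
        (forall p, Z p -> A p) \/ (forall p, Z p -> B p)].

(* Krull dimension at least c. *)
Definition dim_ge Z (c : nat) : Prop :=
  exists W : 'I_c.+1 -> ('M[C]_(k, m) -> Prop),
    (forall i, irreducible_closed (W i) /\ (forall p, W i p -> Z p)) /\
    (forall i j : 'I_c.+1, (i < j)%N ->
       (forall p, W i p -> W j p) /\ (exists p, W j p /\ ~ W i p)).

(* P holds at a general point of L, for L irreducible (or empty, in which case
   there is nothing to check): the open set L \ Z of L is nonempty as soon as
   L is, hence dense. *)
Definition for_general L P : Prop :=
  exists Z, zariski_closed Z /\
    ((exists p, L p) -> exists p, L p /\ ~ Z p) /\
    (forall p, L p -> ~ Z p -> P p).

End Zariski.

Section Osculating.

Variable m : nat.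
Implicit Types (X S : 'rV[C]_m -> Prop) (h p w x : 'rV[C]_m).

Definition lin_span S w : Prop :=
  forall U : {vspace 'rV[C]_m}, (forall v, S v -> v \in U) -> w \in U.

Definition in_hyperplane h w : Prop := h *m w^T = 0.

Definition hyperplane_contains h S : Prop := forall w, S w -> in_hyperplane h w.

Definition hyperplanes_through S h : Prop := h != 0 /\ hyperplane_contains h S.

Definition pmap_at n (phi : 'I_m -> {mpoly C[n]}) (t : 'I_n -> C) : 'rV[C]_m :=
  \row_a (phi a).@[t].

Definition pmap_deriv0 n (phi : 'I_m -> {mpoly C[n]}) (u : 'X_{1..n})
    : 'rV[C]_m :=
  \row_a ((phi a)^`M[u]).@[fun => 0].

(* phi is a polynomial map from C^n to an affine chart C^(m-1) = {z_a = 1} of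
   P^(m-1), with values in X, with phi(0) = p and with injective differential
   at 0.  When n = dim X and p is a smooth point of X, such a phi is a local
   parametrization of X near p; a Segre-Veronese variety has one at each of its
   points, since it is covered by open subsets isomorphic to C^n. *)
Definition local_param X n p (phi : 'I_m -> {mpoly C[n]}) : Prop :=
  [/\ exists a, phi a = 1,
      forall t, X (pmap_at phi t),
      exists c : C, c != 0 /\ pmap_at phi (fun => 0) = c *: p
    & row_free (\matrix_(i < n) pmap_deriv0 phi U_(i))].

(* The cone over the s-osculating space of the n-dimensional variety X at the
   smooth point p.  The cone over the projective closure of an affine subspace
   of the chart {z_a = 1} is its linear span, and the derivative of order 0 is
   phi(0) itself.  This does not depend on the choice of phi. *)
Definition osc_space X n s p w : Prop :=
  exists phi : 'I_m -> {mpoly C[n]}, local_param X p phi /\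
    lin_span (fun v => exists u : 'X_{1..n},
                (mdeg u <= s)%N /\ v = pmap_deriv0 phi u) w.

Definition tangent_at h X n x : Prop :=
  hyperplane_contains h (osc_space X n 1 x).

End Osculating.

(* The dimension n of X is passed explicitly, as in osc_space. *)
Definition tangent_along_pos_dim m (h : 'rV[C]_m) (X : 'rV[C]_m -> Prop) n
    : Prop :=
  exists Y : 'rV[C]_m -> Prop,
    [/\ irreducible_closed Y, forall x, Y x -> X x, dim_ge Y 1
      & forall x, Y x -> tangent_at h X n x].

End Projective.

Definition mono (k e : nat) : finType :=
  {u : 'X_{1..k.+1 < e.+1} | mdeg u == e}.

Lemma card_mono k e : #|mono k e| = 'C(k + e, e).
Proof.
rewrite addnC -(mpoly.size_basis k e) cardE.
rewrite -(size_map (fun u : mono k e => bmnm (val u))).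
apply/perm_size/uniq_perm; last 1 first.
- move=> m; rewrite -basis_cover; apply/mapP/eqP => [[u _ ->]|hm].
    by have /eqP := valP u.
  have lt : (mdeg m < e.+1)%N by rewrite hm.
  have hb : mdeg (BMultinom lt) == e by apply/eqP.
  by exists (Sub (BMultinom lt) hb : mono k e); rewrite ?mem_enum ?SubK.
- by rewrite map_inj_uniq ?enum_uniq // => u v /val_inj /val_inj.
- exact: uniq_basis.
Qed.

Section SegreVeronese.

(* The r of the text is r.+1 here: there is at least one factor, and the first
   one has index ord0. *)
Variables (r : nat) (n d : 'I_r.+1 -> nat).

Definition sv_mono : finType := {dffun forall i : 'I_r.+1, mono (n i) (d i)}.

Definition sv_size : nat := #|sv_mono|.

(* sv_size = N + 1. *)
Lemma sv_sizeE : sv_size = (\prod_i 'C(n i + d i, d i))%N.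
Proof.
rewrite /sv_size card_dep_ffun foldrE big_map big_enum /=.
by apply: eq_bigr => i _; rewrite card_mono.
Qed.

Definition sv_dim : nat := (\sum_i n i)%N.

Variable C : fieldType.

(* The monomials of multidegree d form a basis of the sections of
   O(d_1, ..., d_r). *)
Definition sv_map (x : forall i, 'rV[C]_(n i).+1) : 'rV[C]_sv_size :=
  \row_(a < sv_size)
    \prod_i ('X_[val (enum_val a i)] : {mpoly C[(n i).+1]}).@[fun j => x i 0 j].

Definition SV (z : 'rV[C]_sv_size) : Prop :=
  exists x : forall i, 'rV[C]_(n i).+1, (forall i, x i != 0) /\
  exists c : C, c != 0 /\ z = c *: sv_map x.

End SegreVeronese.

Arguments SV {r} n d {C} z.

(* Main.v *)
(* In coordinates h is a form F_h of multidegree d, tangent at x iff F_h is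
   singular at x, and osculation of order s at p means vanishing of order s + 1
   there.  A linear change of coordinates in each factor moves general points
   p_j to the coordinate points e_j = (e_j, ..., e_j), and the hyperplanes
   containing T become the span of the monomials x^a with
   sum_i a^i_j + d_1 < sum_i d_i for all j.  For general coefficients such a form
   is singular only at the points e_j:
   - at a point whose support carries an allowed monomial, the vector of terms
     c_a x^a lies in the kernel of the exponent matrix, of rank rho, while x^a
     only depends on rho - 1 parameters and a scalar, so the singular forms
     depend on too few parameters to be dense;
   - otherwise all x^i with i > 1 are equal to the same e_j, and the normal
     derivatives of F_h contain n_1 general forms of degree d_1 in the n_1
     coordinates x^1_l, l <> j, which have no common zero.
   Too few parameters means algebraic dependence, which is obtained by counting
   monomials.  A closed irreducible subset of a finite set is a point. *)
From HB Require Import structures.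
Require Import Defs.
From mathcomp Require Import all_boot all_order all_algebra.
From mathcomp Require Import boolp reals zify ring.

Set Implicit Arguments.
Unset Strict Implicit.
Unset Printing Implicit Defensive.

Import Order.TTheory GRing.Theory Num.Theory.
Local Open Scope ring_scope.
Local Open Scope complex_scope.

(** * Polynomial functions *)

(** [osc_space] quantifies existentially over parametrizations, so the two directions of the
    description of T differ in nature. That a hyperplane through T vanishes to order d_1 + 1 at each
    point can be read off one explicit chart. That a hyperplane contains T must be checked along
    every parametrization, hence an argument by equations of the variety. Tangency is only used in
    the first direction. The gap d_1 + 2 <= d_i keeps a monomial allowed when its exponents in a
    factor i > 1 are split between two coordinates, as d_1 + 1 and at least 1, or as d_i - 1 and 1.
    The minimality of n_1 gives the index j a meaning in every factor, and gives each factor i > 1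
    at least n_1 directions normal to e_j: there are as many equations as unknowns, and homogeneity
    saves one parameter. With a single factor no monomial is allowed, no hyperplane contains T, and
    the claim is vacuous. *)

Lemma poly_fun0 (C : numDomainType) (p : {poly C}) :
  (forall s, p.[s] = 0) -> p = 0.
Proof.
move=> p0; apply/eqP/idPn => pn0.
have := @max_poly_roots _ p [seq i%:R | i <- iota 0 (size p)] pn0.
rewrite size_map size_iota ltnn => H; apply: notF; apply: H.
  by apply/allP => _ /mapP[i _ ->]; rewrite rootE p0.
by rewrite map_inj_uniq ?iota_uniq // => i j /eqP; rewrite eqr_nat => /eqP.
Qed.

Lemma digits_inj (B n : nat) (a b : 'I_n -> nat) :
    (forall i, a i < B)%N -> (forall i, b i < B)%N ->
    (\sum_i a i * B ^ i = \sum_i b i * B ^ i)%N -> a =1 b.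
Proof.
elim: n a b => [|n IH] a b aB bB; first by move=> _ [].
have B0 : (0 < B)%N by apply: leq_ltn_trans (aB ord0).
rewrite !big_ord_recl /= expn0 !muln1.
have shift c : (\sum_(i < n) c (lift ord0 i) * B ^ lift ord0 i
    = B * \sum_(i < n) c (lift ord0 i) * B ^ i)%N.
  by rewrite big_distrr; apply: eq_bigr => i _; rewrite /= expnS mulnCA.
have modE u v : (u < B)%N -> ((u + B * v) %% B = u)%N.
  by move=> uB; rewrite addnC mulnC modnMDl modn_small.
rewrite !shift => eqab.
have eq0 : a ord0 = b ord0.
  have := congr1 (modn^~ B) eqab.
  by rewrite !modE.
have eqS : (\sum_(i < n) a (lift ord0 i) * B ^ i
            = \sum_(i < n) b (lift ord0 i) * B ^ i)%N.
  by move: eqab; rewrite eq0 => /addnI /eqP; rewrite eqn_pmul2l // => /eqP.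
move=> i; have [j ->|->] := unliftP ord0 i; last by [].
exact: (IH (fun j => a (lift ord0 j)) (fun j => b (lift ord0 j))).
Qed.

(* Kronecker substitution [x_q := s ^ (B ^ q)]. *)
Lemma monomials_free (C : numDomainType) (Q T : finType) (e : T -> Q -> nat)
    (c : T -> C) :
    (forall t t', e t =1 e t' -> t = t') ->
    (forall x : Q -> C, \sum_t c t * \prod_q x q ^+ e t q = 0) ->
  forall t, c t = 0.
Proof.
move=> einj c0 t0.
pose B := (\max_t \max_q e t q).+1.
have eB t q : (e t q < B)%N.
  by rewrite ltnS (leq_trans _ (leq_bigmax t)) // (leq_bigmax q).
pose w t := (\sum_(i < #|Q|) e t (enum_val i) * B ^ i)%N.
have winj : injective w.
  move=> t t' /(@digits_inj B) H; apply: einj => q.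
  by rewrite -(enum_rankK q); apply: H => i; apply: eB.
pose p : {poly C} := \sum_t c t *: 'X^(w t).
have p0 : p = 0.
  apply: poly_fun0 => s;
    rewrite horner_sum -[RHS](c0 (fun q => s ^+ (B ^ enum_rank q))).
  apply: eq_bigr => t _; rewrite hornerZ hornerXn; congr (_ * _).
  rewrite /w -prodrXr (reindex enum_rank) /=; last first.
    by apply: onW_bij; exists enum_val; [apply: enum_rankK | apply: enum_valK].
  by apply: eq_bigr => q _; rewrite enum_rankK mulnC exprM.
have := congr1 (fun q : {poly C} => q`_(w t0)) p0.
rewrite coef0 coef_sum (bigD1 t0) //= big1 => [|t ne].
  by rewrite coefZ coefXn eqxx mulr1 addr0.
by rewrite coefZ coefXn (inj_eq winj) eq_sym (negbTE ne) mulr0.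
Qed.

Lemma mpoly_fun0 (C : numDomainType) n (p : {mpoly C[n]}) :
  (forall x, p.@[x] = 0) -> p = 0.
Proof.
move=> p0; apply/mpolyP => m; rewrite mcoeff0.
have [|/memN_msupp_eq0 //] := boolP (m \in msupp p) => mp.
have /(_ (SeqSub mp)) : forall t : seq_sub (msupp p), p@_(ssval t) = 0.
  apply: (@monomials_free C 'I_n (seq_sub (msupp p)) (fun t i => (ssval t) i)).
    by move=> t t' e; apply/val_inj/mnmP.
  move=> x; rewrite -[RHS](p0 x) mevalE.
  rewrite -(big_map (fun t : seq_sub (msupp p) => ssval t) predT
     (fun m => p@_m * \prod_i x i ^+ m i)) /=.
  apply: perm_big; apply: uniq_perm.
  - by rewrite map_inj_uniq ?index_enum_uniq //; apply: val_inj.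
  - exact: msupp_uniq.
  move=> m'; apply/mapP/idP => [[t _ ->]|m'p]; first exact: ssvalP.
  by exists (SeqSub m'p); rewrite ?mem_index_enum.
by [].
Qed.

(** * Algebraic dependence *)

Definition mdeg_le (R : comNzRingType) n d (p : {mpoly R[n]}) : Prop :=
  forall m, (d < mdeg m)%N -> p@_m = 0.

Lemma mdeg_leM (R : comNzRingType) n a b (p q : {mpoly R[n]}) :
  mdeg_le a p -> mdeg_le b q -> mdeg_le (a + b) (p * q).
Proof.
move=> pa qb m ltm; rewrite mcoeffM big1 // => -[k1 k2] /= /eqP em.
have {}ltm : (a + b < mdeg k1 + mdeg k2)%N by rewrite -mdegD -em.
case: (ltnP a (mdeg k1)) => [/pa ->|le1]; first by rewrite mul0r.
by rewrite (qb k2) ?mulr0 //; lia.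
Qed.

Lemma mdeg_leX (R : comNzRingType) n a k (p : {mpoly R[n]}) :
  mdeg_le a p -> mdeg_le (k * a) (p ^+ k).
Proof.
move=> pa; elim: k => [|k IH] m lem.
  by rewrite expr0 mcoeff1; case: eqP lem => // ->; rewrite mdeg0.
by rewrite exprS (mdeg_leM pa IH) // -mulSn.
Qed.

Lemma mdeg_le_prod (R : comNzRingType) n N (a : 'I_N -> nat)
    (p : 'I_N -> {mpoly R[n]}) :
  (forall i, mdeg_le (a i) (p i)) -> mdeg_le (\sum_i a i) (\prod_i p i).
Proof.
move=> pa; elim/big_rec2: _ => [m|i q d _ IH]; last exact: mdeg_leM.
by rewrite mcoeff1; case: eqP => // ->; rewrite mdeg0.
Qed.

(** Counting: the products of powers of the [f i] with exponents at most t number B^(N^2), and they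
    lie in a space of polynomials of dimension at most (b + 1)^n, where b + 1 <= B (t + 1) = B^(N +
    1). As n <= N - 1, one has (N + 1) n < N^2, so these products are linearly dependent. *)
Lemma alg_dep (C : numFieldType) N n (f : 'I_N -> {mpoly C[n]}) :
    (n < N)%N ->
  exists D : {mpoly C[N]}, D != 0 /\ forall x, D.@[fun i => (f i).@[x]] = 0.
Proof.
move=> nN; pose e := (\max_i msize (f i))%N.
pose B := (N * e).+2; pose t := (B ^ N).-1; pose b := (N * (t * e))%N.
have tE : t.+1 = (B ^ N)%N by rewrite prednK // expn_gt0.
pose U := {ffun 'I_N -> 'I_t.+1}; pose V := {ffun 'I_n -> 'I_b.+1}.
have UV : (#|{: V}| < #|{: U}|)%N.
  rewrite !card_ffun !card_ord tE -expnM.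
  have leb : (b.+1 <= B ^ N.+1)%N.
    rewrite expnS -tE /b /B; nia.
  apply: (@leq_ltn_trans ((B ^ N.+1) ^ n)); first by case: (n) => // k;
    rewrite leq_exp2r.
  by rewrite -expnM ltn_exp2l //; nia.
pose F (u : U) := \prod_i f i ^+ u i.
have Fb u : mdeg_le b (F u).
  move=> m lem; apply: (@mdeg_le_prod _ _ _ (fun i => u i * e)%N) => [i|].
    apply: mdeg_leX => m' lem'; apply: memN_msupp_eq0; apply/negP => /msize_mdeg_lt.
    by apply/negP; rewrite -leqNgt; apply: leq_trans (ltnW lem'); apply: leq_bigmax.
  apply: leq_ltn_trans lem; rewrite /b -[N in leqRHS]card_ord -sum_nat_const.
  by apply: leq_sum => i _; rewrite leq_mul2r -ltnS ltn_ord orbT.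
pose A : 'M[C]_(#|{: U}|, #|{: V}|) := \matrix_(i, j)
  (F (enum_val i))@_[multinom nat_of_ord ((enum_val j : V) l) | l < n].
have : kermx A != 0.
  rewrite kermx_eq0 /row_free neq_ltn; apply/orP; left.
  by apply: leq_ltn_trans UV; apply: rank_leq_col.
move/matrix0Pn=> [i0 [j0 nz]]; pose k := row i0 (kermx A).
have kA : k *m A = 0.
  by apply/row_matrixP => i; rewrite -row_mul mulmx_ker !row0.
pose mU (j : 'I_#|{: U}|) : 'X_{1..N} := [multinom nat_of_ord ((enum_val j : U) l)
  | l < N].
have mU_inj : injective mU.
  move=> i j /mnmP eij; apply: enum_val_inj; apply/ffunP => l.
  by have := eij l; rewrite !mnmE => /val_inj.
pose D : {mpoly C[N]} := \sum_j k 0 j *: 'X_[mU j].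
exists D; split.
  apply/eqP => /(congr1 (mcoeff (mU j0))) /eqP; rewrite mcoeff0.
  rewrite raddf_sum (bigD1 j0) //= big1 => [|j ne].
    by rewrite mcoeffZ mcoeffX eqxx mulr1 addr0 mxE (negbTE nz).
  by rewrite mcoeffZ mcoeffX (inj_eq mU_inj) (negbTE ne) mulr0.
have F0 : \sum_j k 0 j *: F (enum_val j) = 0.
  apply/mpolyP => m; rewrite mcoeff0 raddf_sum /=.
  have [mb|] := leqP (mdeg m) b; last first.
    by move=> mb; rewrite big1 // => j _; rewrite mcoeffZ Fb ?mulr0.
  have mlt l : (m l < b.+1)%N.
    by rewrite ltnS (leq_trans _ mb) // mdegE (bigD1 l) //= leq_addr.
  pose v : V := [ffun l => Ordinal (mlt l)].
  have := congr1 (fun M : 'rV_ _ => M 0 (enum_rank v)) kA.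
  rewrite !mxE => eq0; rewrite -[RHS]eq0; apply: eq_bigr => j _.
  rewrite mcoeffZ [A _ _]mxE enum_rankK; congr (_ * mcoeff _ _).
  by apply/mnmP => l; rewrite mnmE ffunE.
move=> x; have := congr1 (meval x) F0; rewrite meval0 => eq0; rewrite -[RHS]eq0.
rewrite !raddf_sum; apply: eq_bigr => j _; rewrite /= !mevalZ mevalX.
congr (_ * _); rewrite /F rmorph_prod; apply: eq_bigr => l _.
by rewrite rmorphXn mnmE.
Qed.

(** * Thin sets of coefficients *)

(** Failure of Zariski density, witnessed by a single polynomial. No closedness or constructibility
    of [B] is asked, so the sets of singular forms can be used as they come, without elimination. *)
Definition thin (C : numFieldType) N (B : ('I_N -> C) -> Prop) : Prop :=
  exists2 D : {mpoly C[N]}, D != 0 & forall c, B c -> D.@[c] = 0.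

Lemma thin_image (C : numFieldType) N n (f : 'I_N -> {mpoly C[n]})
    (B : ('I_N -> C) -> Prop) :
  (n < N)%N -> (forall c, B c -> exists x, forall i, c i = (f i).@[x]) -> thin B.
Proof.
move=> nN Bf; have [D [D0 Df]] := alg_dep f nN; exists D => // c /Bf[x cx].
by rewrite -[RHS](Df x); apply: meval_eq.
Qed.

Lemma thinS (C : numFieldType) N (B B' : ('I_N -> C) -> Prop) :
  (forall c, B c -> B' c) -> thin B' -> thin B.
Proof. by move=> BB' [D D0 DB']; exists D => // c /BB'/DB'. Qed.

Lemma thin_union (C : numFieldType) N (J : finType)
    (B : J -> ('I_N -> C) -> Prop) :
  (forall j, thin (B j)) -> thin (fun c => exists j, B j c).
Proof.
move=> thB.
have ex j : exists D : {mpoly C[N]}, D != 0 /\ forall c, B j c -> D.@[c] = 0.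
  by have [D D0 DB] := thB j; exists D.
have [D HD] := fin_all_exists ex.
exists (\prod_j D j).
  by apply/prodf_neq0 => j _; have [] := HD j.
move=> c [j Bj]; rewrite (bigD1 j) //= mevalM.
by have [_ /(_ c Bj) ->] := HD j; rewrite mul0r.
Qed.

Lemma thin_comp (C : numFieldType) N N' (iota : 'I_N' -> 'I_N)
    (B : ('I_N' -> C) -> Prop) :
  injective iota -> thin B -> thin (fun c => B (c \o iota)).
Proof.
move=> inj [D D0 DB]; exists (D \mPo [tuple 'X_(iota i) | i < N']).
  apply: contra D0 => /eqP Di0; apply/eqP/mpoly_fun0 => x.
  (* Extension by zero: its restriction along [iota] is x. *)
  pose c j := if [pick i | iota i == j] is Some i then x i else 0.
  have := congr1 (meval c) Di0; rewrite meval0 comp_mpoly_meval => eq0.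
  rewrite -[RHS]eq0; apply: meval_eq => i; rewrite tnth_mktuple mevalXU /c.
  by case: pickP => [j /eqP/inj ->|/(_ i)] //; rewrite eqxx.
move=> c Bc; rewrite comp_mpoly_meval -[RHS](DB _ Bc).
by apply: meval_eq => i; rewrite tnth_mktuple mevalXU.
Qed.

Lemma common_denominator (I : finType) (f : I -> rat) :
  exists2 M : nat, (0 < M)%N &
    exists z : I -> int, forall i, M%:R * f i = (z i)%:~R.
Proof.
exists (\prod_i `|denq (f i)|)%N.
  by rewrite prodn_gt0 // => i; rewrite absz_gt0 denq_neq0.
exists (fun i => numq (f i) * (\prod_(j | j != i) `|denq (f j)|)%N%:Z) => i.
rewrite (bigD1 i) //= natrM intrM mulrAC; congr (_ * _).
by rewrite -[`|_|%N%:R]/(`|denq (f i)|%N%:Z%:~R) absz_denq mulrC -numqE.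
Qed.

(** * Exponent matrices and singular forms on the torus *)

Section Toric.

Variables (C : numClosedFieldType) (Q : finType) (N D : nat).
Variable E : 'I_N -> Q -> nat.
Hypotheses (N_gt0 : (0 < N)%N) (D_gt0 : (0 < D)%N).
Hypothesis E_deg : forall a, (\sum_q E a q = D)%N.

Let row_of (F : fieldType) q : 'rV[F]_N := \row_a (E a q)%:R.
Let Emx (F : fieldType) : 'M[F]_(#|Q|, N) := \matrix_(i, a) (E a (enum_val i))%:R.
Let one : 'rV[rat]_N := const_mx 1.

(** J is maximal with #|J| < rank (V J); the empty set qualifies thanks to the constant row. By
    maximality every row lies in V J. The constant row is itself in the row space, since each column
    sums to D; this is why one row fewer than the rank suffices. *)
Lemma exponent_basis :
  exists J : {set Q}, (#|J| < \rank (Emx rat))%N /\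
  forall q, exists ab : rat * (Q -> rat),
    row_of rat q = ab.1 *: one + \sum_(l in J) ab.2 l *: row_of rat l.
Proof.
pose V (J : {set Q}) := (one + \sum_(q in J) <<row_of rat q>>)%MS.
pose P (J : {set Q}) := (#|J| < \rank (V J))%N.
have P0 : P set0.
  rewrite /P cards0 lt0n mxrank_eq0; apply/eqP => V0.
  have : (one <= V set0)%MS by apply: addsmxSl.
  rewrite V0 submx0 => /eqP/rowP/(_ (Ordinal N_gt0)).
  by rewrite !mxE => /eqP; rewrite oner_eq0.
have [J PJ Jmax] := @arg_maxnP _ set0 P (fun J => #|J|) P0.
have rowE q : row_of rat q = row (enum_rank q) (Emx rat).
  by apply/rowP => a; rewrite !mxE enum_rankK.
have VE : (V J <= Emx rat)%MS.
  rewrite addsmx_sub; apply/andP; split; last first.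
    by apply/sumsmx_subP => q _; rewrite genmxE rowE row_sub.
  suff -> : one = (const_mx D%:R^-1 : 'rV_#|Q|) *m Emx rat by apply: submxMl.
  apply/rowP => a; rewrite !mxE (reindex enum_rank) /=; last first.
    by apply: onW_bij; exists enum_val; [apply: enum_rankK | apply: enum_valK].
  under eq_bigr => q _ do rewrite !mxE enum_rankK.
  by rewrite -mulr_sumr -natr_sum E_deg mulVf // pnatr_eq0 -lt0n.
have sub q : (row_of rat q <= V J)%MS.
  apply/idPn => nsub.
  have qJ : q \notin J.
    apply: contra nsub => qJ; apply: submx_trans (addsmxSr _ _).
    by rewrite -(genmxE (row_of rat q)) (sumsmx_sup q).
  have VqJ : (V J < V (q |: J))%MS.
    rewrite ltmxE; apply/andP; split.
      rewrite addsmxS //; apply/sumsmx_subP => l lJ; apply: (sumsmx_sup l) => //.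
      by rewrite !inE lJ orbT.
    apply: contra nsub; apply: submx_trans; apply: submx_trans (addsmxSr _ _).
    by rewrite -(genmxE (row_of rat q)) (sumsmx_sup q) // setU11.
  have /Jmax : P (q |: J).
    by rewrite /P cardsU1 qJ add1n; apply: leq_ltn_trans PJ (rank_ltmx VqJ).
  by rewrite /= cardsU1 qJ add1n ltnn.
exists J; split; first exact: leq_trans PJ (mxrankS VE).
move=> q; have /sub_addsmxP[[u1 u2] /= ->] := sub q.
have /sub_rVP[a ->] : (u1 *m one <= one)%MS by apply: submxMl.
have /sub_sumsmxP[u ->] : (u2 *m (\sum_(q in J) <<row_of rat q>>)%MS <=
   \sum_(q in J) <<row_of rat q>>)%MS by apply: submxMl.
have exb l : exists b, u l *m <<row_of rat l>>%MS = b *: row_of rat l.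
  by apply/sub_rVP; rewrite -(genmxE (row_of rat l)) submxMl.
have [b Hb] := fin_all_exists exb.
by exists (a, b); congr (_ + _); apply: eq_bigr => l _; rewrite Hb.
Qed.

(* On the torus, [y ^ E a] only depends on #|J| = rank - 1 coordinates and a
   common scalar (the [M]-th roots absorb the denominators), while the vector of
   terms [c a * y ^ E a] lies in the kernel of [E]. *)
Lemma toric_thin :
  thin (fun c : 'I_N -> C => exists y : Q -> C, (forall q, y q != 0) /\
    forall q, \sum_a c a * (\prod_l y l ^+ E a l) * (E a q)%:R = 0).
Proof.
have [J [ltJ HJ]] := exponent_basis.
have [/= ab Hab] := fin_all_exists HJ.
have [M M0 [z Hz]] := common_denominator
  (fun p : Q * option Q => if p.2 is Some l then (ab p.1).2 l else (ab p.1).1).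
have ME a q : (M * E a q)%:Z = z (q, None) + \sum_(l in J) z (q, Some l) * (E a l)%:Z.
  apply/eqP; rewrite -(@eqr_int rat) rmorphD rmorph_sum /= PoszM rmorphM /=.
  have /rowP/(_ a) := Hab q; rewrite !mxE summxE => Eq.
  apply/eqP; rewrite -[(E a q)%:~R]/((E a q)%:R) Eq mulrDr mulr1 (Hz (q, None)).
  congr (_ + _); rewrite mulr_sumr; apply: eq_bigr => l _.
  by rewrite !mxE mulrA (Hz (q, Some l)) rmorphM.
pose Kmx := row_base (kermx (Emx C)^T); pose k := \rank (kermx (Emx C)^T).
pose f a : {mpoly C[k + #|J|]} :=
  (\sum_b Kmx b a *: 'X_(lshift _ b)) *
  \prod_(q < #|J|) 'X_(rshift _ q) ^+ E a (enum_val q).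
apply: (@thin_image _ _ _ f).
  (* The relations live over the rationals, but the rank is the same over C: the kernel has
     dimension N - rank, and adding #|J| < rank parameters stays below N. *)
  have rkE : \rank (Emx C) = \rank (Emx rat).
    rewrite -(mxrank_map (@ratr C) (Emx rat)); congr (\rank _).
    by apply/matrixP => i j; rewrite !mxE rmorph_nat.
  have := mxrank_ker (Emx C)^T; rewrite mxrank_tr rkE -/k => ->.
  have := rank_leq_col (Emx rat); move: ltJ; lia.
move=> c [y [y0 Hy]].
(* The coefficient c a is the kernel term times the inverse of y ^ E a, so it is the inverses of the
   coordinates whose roots are taken. *)
pose zt l := M.-root (y l)^-1.
have ztM l : zt l ^+ M = (y l)^-1 by apply: rootCK.
have zt0 l : zt l != 0.
  have : zt l ^+ M != 0 by rewrite ztM invr_neq0.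
  by rewrite expf_eq0 M0.
pose lam := \prod_l zt l ^ z (l, None).
pose w q := \prod_l zt l ^ z (l, Some q).
have yE a : (\prod_l y l ^+ E a l)^-1 = lam * \prod_(q in J) w q ^+ E a q.
  under [in RHS]eq_bigr => q _ do rewrite -prodrXl.
  rewrite exchange_big -big_split -prodfV; apply: eq_bigr => l _ /=.
  rewrite -exprVn -ztM -exprM -[LHS]/(zt l ^ (M * E a l)%N%:Z) ME expfzDr //.
  congr (_ * _); rewrite (big_morph (fun i => zt l ^ i) (id1 := 1) (op1 := *%R)) //.
    by apply: eq_bigr => q _; rewrite -exprz_exp.
  by move=> i j; rewrite expfzDr.
(* The scalar [lam] is absorbed into the kernel vector and costs no parameter. *)
pose v : 'rV[C]_N := \row_a (lam * (c a * \prod_l y l ^+ E a l)).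
have /submxP[u uE] : (v <= Kmx)%MS.
  rewrite eq_row_base; apply/sub_kermxP/rowP => i; rewrite !mxE.
  rewrite -[RHS](mulr0 lam) -[in RHS](Hy (enum_val i)) mulr_sumr.
  by apply: eq_bigr => a _; rewrite !mxE !mulrA.
exists (fun i => match split i with inl b => u 0 b | inr q => w (enum_val q) end).
move=> a; rewrite mevalM (rmorph_sum (meval _)) (rmorph_prod (meval _)) /=.
have -> : \sum_b (Kmx b a *: 'X_(lshift #|J| b)).@[fun i => match split i with
    inl b => u 0 b | inr q => w (enum_val q) end] = v 0 a.
  rewrite uE !mxE; apply: eq_bigr => b _.
  by rewrite mevalZ mevalXU (unsplitK (inl b)) mulrC.
have -> : \prod_(q < #|J|) ('X_(rshift k q) ^+ E a (enum_val q)).@[fun i =>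
    match split i with inl b => u 0 b | inr q => w (enum_val q) end]
    = \prod_(q in J) w q ^+ E a q.
  rewrite [RHS]big_enum_val; apply: eq_bigr => q _.
  by rewrite rmorphXn /= mevalXU (unsplitK (inr q)).
rewrite mxE mulrAC -yE mulrCA mulVf ?mulr1 //.
by apply/prodf_neq0 => l _; rewrite expf_neq0.
Qed.

End Toric.

(* After normalizing [y l0 = 1] the k-th equation expresses the coefficient
   [c (s k)] through the other ones, so that a solvable system is determined by
   N - #|K| + #|L| - 1 parameters. *)
Lemma forms_thin (C : numFieldType) N (K L : finType) (d : nat)
    (A : K -> pred 'I_N) (E : 'I_N -> L -> nat) (s : K -> 'I_N) (l0 : L) :
    (#|L| <= #|K|)%N ->
    (forall k k' a, A k a -> A k' a -> k = k') ->
    (forall k a, A k a -> (\sum_l E a l = d)%N) ->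
    (forall k, A k (s k)) -> (forall k l, l != l0 -> E (s k) l = 0%N) ->
  thin (fun c : 'I_N -> C => exists y : L -> C, y l0 != 0 /\
    forall k, \sum_(a | A k a) c a * \prod_l y l ^+ E a l = 0).
Proof.
move=> LK disj deg As Es.
have s_inj : injective s by move=> k k' e; apply: (disj _ _ (s k)); rewrite ?As // e As.
pose P : finType := ({a | a \notin codom s} + {l | l != l0})%type.
pose X (p : P) : {mpoly C[#|P|]} := 'X_(enum_rank p).
pose Xa a : {mpoly C[#|P|]} := if insub a is Some u then X (inl u) else 0.
pose Xl l : {mpoly C[#|P|]} := if insub l is Some u then X (inr u) else 1.
pose f a := if [pick k | s k == a] is Some k
  then - \sum_(b | A k b && (b != a)) Xa b * \prod_l Xl l ^+ E b l else Xa a.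
apply: (@thin_image _ _ _ f).
  have cardL : (#|{: {l | l != l0}}| = #|L|.-1)%N.
    by rewrite card_sig -(cardC1 l0); apply: eq_card => l; rewrite !inE.
  have cards : (#|{: {a | a \notin codom s}}| + #|K| = N)%N.
    rewrite card_sig -(card_codom s_inj) addnC -[RHS]card_ord -(cardC (mem (codom s))).
    by congr (_ + _)%N; apply: eq_card => a; rewrite !inE.
  have L0 : (0 < #|L|)%N by apply/card_gt0P; exists l0.
  by rewrite card_sum cardL -[X in (_ < X)%N]cards ltn_add2l; case: #|L| L0 LK.
move=> c [y [y0 Hy]].
pose x (p : P) := match p with
  | inl u => c (val u) | inr u => y (val u) / y l0 end.
pose v (i : 'I_#|P|) := x (enum_val i).
have vX p : (X p).@[v] = x p by rewrite mevalXU /v enum_rankK.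
have vXa a : a \notin codom s -> (Xa a).@[v] = c a.
  by rewrite /Xa; case: insubP => [u _ <- _|/negbTE ->] //; rewrite vX.
have vXl l : (Xl l).@[v] = y l / y l0.
  rewrite /Xl; case: insubP => [u _ <-|]; first by rewrite vX.
  by rewrite negbK => /eqP ->; rewrite meval1 divff.
exists v => a; rewrite /f; case: pickP => [k /eqP <-|sa]; last first.
  by rewrite vXa //; apply/codomP => -[k e]; have := sa k; rewrite e eqxx.
have ps : \prod_l (y l / y l0) ^+ E (s k) l = 1.
  rewrite big1 // => l _; have [->|ne] := eqVneq l l0; last by rewrite Es.
  by rewrite divff // expr1n.
(* Homogeneity of degree d: normalizing y l0 to 1 divides the equation by y l0 ^ d. *)
have tot : \sum_(b | A k b) c b * \prod_l (y l / y l0) ^+ E b l = 0.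
  rewrite -[RHS](mul0r (y l0 ^- d)) -[X in _ = X * _](Hy k) mulr_suml.
  apply: eq_bigr => b Ab; rewrite -mulrA -(deg _ _ Ab) -prodrXr -prodfV -big_split /=.
  by congr (_ * _); apply: eq_bigr => l _; rewrite expr_div_n.
move: tot; rewrite (bigD1 (s k)) //= ps mulr1 => /eqP.
rewrite addr_eq0 => /eqP ->; rewrite mevalN (rmorph_sum (meval _)) /=.
congr (- _); apply: eq_bigr => b /andP[Ab bs]; rewrite mevalM vXa.
  by rewrite rmorph_prod; congr (_ * _); apply: eq_bigr => l _; rewrite rmorphXn /= vXl.
apply/codomP => -[k' e]; move/negP: bs; apply; rewrite e (disj k k' b) //.
by rewrite e.
Qed.

(** * Multihomogeneous forms *)

Lemma prod_sum_dffun (R : comNzRingType) (I : finType) (T : I -> finType)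
    (F : forall i, T i -> R) :
  \prod_i \sum_(t : T i) F i t
  = \sum_(f : {dffun forall i, T i}) \prod_i F i (f i).
Proof.
have -> : \prod_i \sum_(t : T i) F i t
  = \prod_i \sum_(j in tagged_with T i) untag 0 (F i) j.
  by apply: eq_bigr => i _; rewrite big_tag.
rewrite bigA_distr_big_dep /=.
transitivity (\sum_(g in family (tagged_with T))
    \prod_i untag 0 [ffun t => F i t] (g i)).
  apply: eq_bigr => g /familyP gT; apply: eq_bigr => i _.
  move: (gT i); rewrite inE => /eqP e.
  by rewrite !untagE ffunE.
rewrite -(@big_fprod R 0 1 *%R +%R I T (fun i => [ffun t => F i t])).
rewrite (reindex (@fprod_of_dffun _ T)) /=; last exact/onW_bij/fprod_of_dffun_bij.
by apply: eq_bigr => f _; apply: eq_bigr => i _; rewrite ffunE fprodE.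
Qed.

Lemma dhomog_meval (C : comNzRingType) k e (p : {mpoly C[k.+1]}) x :
  p \is e.-homog ->
  p.@[x] = \sum_(u : mono k e) p@_(val u) * ('X_[val u] : {mpoly C[_]}).@[x].
Proof.
move=> hp; have sp : (msize p <= e.+1)%N.
  rewrite msizeE; apply/bigmax_leqP_seq => m mp _.
  by rewrite ltnS (dhomog_mf hp mp).
rewrite [in LHS](mpolywE sp) raddf_sum (bigID (fun m => mdeg (bmnm m) == e)) /=.
rewrite [X in _ + X]big1 ?addr0 => [|m ne]; last first.
  by rewrite mevalZ (dhomog_nemf_coeff hp) ?mul0r.
rewrite (reindex_omap (val : mono k e -> _) insub) => [|m em]; last first.
  by rewrite insubT.
by apply: eq_big => [u|u _]; rewrite ?mevalZ // (valP u) valK eqxx.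
Qed.

Section Forms.

Variables (r : nat) (n d : 'I_r.+1 -> nat) (C : numClosedFieldType).
Notation svs := (sv_size n d).
Notation pt := (forall i, 'rV[C]_(n i).+1).

Definition expo (a : 'I_svs) (i : 'I_r.+1) (k : 'I_(n i).+1) : nat :=
  val (enum_val a i) k.
Arguments expo : clear implicits.

Lemma expo_sum a i : (\sum_k expo a i k = d i)%N.
Proof. by have /eqP := valP (enum_val a i); rewrite mdegE. Qed.

Lemma expo_inj a b : (forall i k, expo a i k = expo b i k) -> a = b.
Proof.
move=> eab; apply: enum_val_inj; apply/ffunP => i.
by apply/val_inj/val_inj/mnmP => k; apply: eab.
Qed.

Lemma expo_ex (e : forall i, 'I_(n i).+1 -> nat) :
  (forall i, \sum_k e i k = d i)%N -> exists a, forall i k, expo a i k = e i k.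
Proof.
move=> se.
have mu i : mdeg [multinom e i k | k < (n i).+1] = d i.
  by rewrite mdegE -[RHS]se; apply: eq_bigr => k _; rewrite mnmE.
have lt i : (mdeg [multinom e i k | k < (n i).+1] < (d i).+1)%N by rewrite mu.
have eq i : mdeg (BMultinom (lt i)) == d i by rewrite /= mu.
pose f : sv_mono n d := [ffun i => Sub (BMultinom (lt i)) (eq i)].
exists (enum_rank f) => i k.
by rewrite /expo enum_rankK ffunE SubK /= mnmE.
Qed.

Definition mon (A : comNzRingType) (x : forall i, 'I_(n i).+1 -> A) a : A :=
  \prod_i \prod_k x i k ^+ expo a i k.

Lemma eq_mon (A : comNzRingType) (x y : forall i, 'I_(n i).+1 -> A) a :
  (forall i k, x i k = y i k) -> mon x a = mon y a.
Proof. by move=> xy; apply: eq_bigr => i _; apply: eq_bigr => k _; rewrite xy. Qed.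

Lemma rmorph_mon (A B : comNzRingType) (f : {rmorphism A -> B}) x a :
  f (mon x a) = mon (fun i k => f (x i k)) a.
Proof.
rewrite rmorph_prod; apply: eq_bigr => i _; rewrite rmorph_prod.
by apply: eq_bigr => k _; rewrite rmorphXn.
Qed.

Lemma mon_sig (A : comNzRingType) (x : forall i, 'I_(n i).+1 -> A) a :
  mon x a = \prod_(q : {i : 'I_r.+1 & 'I_(n i).+1})
              x (tag q) (tagged q) ^+ expo a (tag q) (tagged q).
Proof. by rewrite /mon (sig_big_dep _ _ (fun i k => x i k ^+ expo a i k)). Qed.

Definition coords (x : pt) : forall i, 'I_(n i).+1 -> C := fun i k => x i 0 k.

Lemma sv_mapE (x : pt) a : sv_map d x 0 a = mon (coords x) a.
Proof. by rewrite mxE; apply: eq_bigr => i _; rewrite mevalX. Qed.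

Definition sv_form (h : 'rV[C]_svs) (x : pt) : C := \sum_a h 0 a * mon (coords x) a.

Lemma sv_formE h x : sv_form h x = (h *m (sv_map d x)^T) 0 0.
Proof. by rewrite !mxE; apply: eq_bigr => a _; rewrite [_^T a 0]mxE sv_mapE. Qed.

Lemma sv_form_eq0 h : (forall x, sv_form h x = 0) -> h = 0.
Proof.
move=> h0; apply/rowP => a; rewrite mxE.
apply: (@monomials_free C {i : 'I_r.+1 & 'I_(n i).+1} 'I_svs
  (fun a q => expo a (tag q) (tagged q)) (h 0)).
  by move=> b b' e; apply: expo_inj => i k; apply: (e (Tagged _ k)).
move=> y; rewrite -[RHS](h0 (fun i => \row_k y (Tagged _ k))).
apply: eq_bigr => b _; rewrite mon_sig; congr (_ * _).
by apply: eq_bigr => -[i k] _; rewrite /coords mxE.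
Qed.

Definition act (g : forall i, 'M[C]_((n i).+1)) (x : pt) : pt := fun i => x i *m g i.

(** A monomial in the coordinates of the x i *m g i expands in monomials of the same multidegree; G
    is the action of g on the tensor product of the d_i-th symmetric powers. *)
Lemma sv_map_act (g : forall i, 'M[C]_((n i).+1)) :
  exists G : 'M[C]_svs, forall x, sv_map d (act g x) = sv_map d x *m G.
Proof.
pose p a i : {mpoly C[(n i).+1]} :=
  \prod_k (\sum_l g i l k *: 'X_l) ^+ expo a i k.
have hp a i : p a i \is (d i).-homog.
  rewrite -(expo_sum a i) /p; elim/big_rec2: _ => [|k e q _ hq].
    by rewrite dhomog1.
  apply: dhomogM => //.
  suff /(dhomogMn (expo a i k)) : (\sum_l g i l k *: 'X_l : {mpoly C[(n i).+1]})
    \is 1.-homog.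
    by rewrite mul1n.
  by apply: rpred_sum => l _; apply: dhomogZ; rewrite dhomogX /= mdeg1.
exists (\matrix_(b, a) \prod_i (p a i)@_(val ((enum_val b : sv_mono n d) i))) => x.
apply/rowP => a; rewrite sv_mapE mxE.
transitivity (\prod_i (p a i).@[x i 0]).
  apply: eq_bigr => i _; rewrite rmorph_prod; apply: eq_bigr => k _.
  rewrite rmorphXn /= raddf_sum /= /coords mxE; congr (_ ^+ _).
  by apply: eq_bigr => l _; rewrite mevalZ mevalXU mulrC.
under eq_bigr => i _ do rewrite (dhomog_meval _ (hp a i)).
rewrite prod_sum_dffun (reindex (fun b : 'I_svs => enum_val b : sv_mono n d)) /=;
  last first.
  apply: onW_bij; exists (@enum_rank (sv_mono n d)); first exact: enum_valK.
  exact: (@enum_rankK (sv_mono n d)).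
apply: eq_bigr => b _; rewrite [_ b a]mxE big_split mulrC /= [sv_map _ _ _ _]mxE.
by [].
Qed.

Definition line_form (h : 'rV[C]_svs) (x w : pt) : {poly C} :=
  \sum_a (h 0 a)%:P * mon (fun i k => (x i 0 k)%:P + (w i 0 k)%:P * 'X) a.

Lemma line_formE h x w s : (line_form h x w).[s] = sv_form h (fun i => x i + s *: w i).
Proof.
rewrite /line_form horner_sum; apply: eq_bigr => a _; rewrite hornerM hornerC.
congr (_ * _); rewrite -[_.[s]]/(horner_eval s _) rmorph_mon /=.
by apply: eq_mon => i k; rewrite /horner_eval !hornerE /coords !mxE [s * _]mulrC.
Qed.

(* Vanishing to order e at x, tested on the lines s |-> x + s w through x in
   the product of the affine cones. *)
Definition vanish (e : nat) (h : 'rV[C]_svs) (x : pt) : Prop :=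
  forall w, 'X^e %| line_form h x w.

Lemma vanish_act g (G : 'M[C]_svs) e h x :
  (forall x, sv_map d (act g x) = sv_map d x *m G) ->
  vanish e h (act g x) -> vanish e (h *m G^T) x.
Proof.
move=> gG vh w; suff -> : line_form (h *m G^T) x w = line_form h (act g x) (act g
  w) by [].
apply/eqP; rewrite -subr_eq0; apply/eqP/poly_fun0 => s.
rewrite hornerD hornerN !line_formE !sv_formE -mulmxA -trmx_mul -gG.
apply/eqP; rewrite subr_eq0; apply/eqP; rewrite -!sv_formE.
apply: eq_bigr => a _; congr (_ * _); apply: eq_mon => i k.
by rewrite /coords /act mulmxDl -scalemxAl.
Qed.

End Forms.
Arguments expo {r n d} a i k.

(** * Vanishing orders and osculating spaces *)

Lemma meval_at0 (C : comNzRingType) k (p : {mpoly C[k]}) : p.@[fun=> 0] = p@_0%MM.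
Proof.
rewrite {1 2}[p]mpolyE !raddf_sum; apply: eq_bigr => m _ /=.
rewrite mevalZ mcoeffZ mevalX mcoeffX; congr (_ * _).
have [->|m0] := eqVneq m 0%MM; first by rewrite big1 // => i _; rewrite mnm0E.
have [i mi] : exists i, m i != 0%N.
  apply/existsP; apply: contraR m0; rewrite negb_exists => /forallP m0.
  by apply/eqP/mnmP => i; move: (m0 i); rewrite negbK mnm0E => /eqP.
by rewrite (bigD1 i) //= expr0n (negbTE mi) mul0r.
Qed.

Lemma mderivm_at0 (C : numDomainType) k (p : {mpoly C[k]}) u :
  (p^`M[u]).@[fun=> 0] = 0 <-> p@_u = 0.
Proof.
rewrite meval_at0 mcoeff_mderivm addm0; split=> [/eqP|->]; last by rewrite mul0rn.
rewrite mulrn_eq0 => /orP[|/eqP//].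
by rewrite -leqn0 leqNgt prodn_gt0 // => i; rewrite ffactnn fact_gt0.
Qed.

Lemma dvdp_sub_prod (F : fieldType) (I : finType) (M : {poly F}) (p q : I -> {poly F}) :
  (forall i, M %| p i - q i) -> M %| \prod_i p i - \prod_i q i.
Proof.
move=> Mpq; elim/big_rec2: _ => [|i x y _ IH]; first by rewrite subrr dvdp0.
have -> : p i * y - q i * x = p i * (y - x) + (p i - q i) * x by ring.
by apply: dvdp_add; [apply: dvdp_mull | apply: dvdp_mulr].
Qed.

Lemma dvdp_subX (F : fieldType) (M p q : {poly F}) e :
  M %| p - q -> M %| p ^+ e - q ^+ e.
Proof. by move=> Mpq; rewrite subrXX dvdp_mulr. Qed.

(** * Osculation read in an affine chart *)

Section Chart.

Variables (r : nat) (n d : 'I_r.+1 -> nat) (C : numClosedFieldType).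
Notation svs := (sv_size n d).
Notation pt := (forall i, 'rV[C]_(n i).+1).
Hypothesis d_gt0 : forall i, (0 < d i)%N.

Lemma dvdp_sub_mon (M : {poly C}) (p q : forall i, 'I_(n i).+1 -> {poly C}) a :
  (forall i k, M %| p i k - q i k) -> M %| mon (d := d) p a - mon q a.
Proof.
by move=> Mpq; apply: dvdp_sub_prod => i; apply: dvdp_sub_prod => k; apply: dvdp_subX.
Qed.

Lemma mon_scale (A : comNzRingType) (l : 'I_r.+1 -> A) (z : forall i, 'I_(n i).+1
  -> A) a :
  mon (d := d) (fun i k => l i * z i k) a = \prod_i l i ^+ d i * mon z a.
Proof.
rewrite /mon -big_split; apply: eq_bigr => i _ /=.
rewrite -(expo_sum a i) -prodrXr -big_split /=.
by apply: eq_bigr => k _; rewrite exprMn.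
Qed.

Lemma SV_normal (z : 'rV[C]_svs) : SV n d z ->
  exists (x : pt) (piv : forall i, 'I_(n i).+1), (forall i, x i 0 (piv i) = 1) /\
  exists2 c : C, c != 0 & z = c *: sv_map d x.
Proof.
move=> [x [x0 [c [c0 ->]]]].
have ex i : exists k, x i 0 k != 0 by apply/rV0Pn.
have [piv Hp] := fin_all_exists ex.
exists (fun i => (x i 0 (piv i))^-1 *: x i), piv; split=> [i|].
  by rewrite mxE mulVf.
exists (c * \prod_i (x i 0 (piv i)) ^+ d i).
  by rewrite mulf_neq0 //; apply/prodf_neq0 => i _; rewrite expf_neq0.
apply/rowP => a; rewrite [RHS]mxE [LHS]mxE !sv_mapE -mulrA; congr (_ * _).
rewrite -mon_scale; apply: eq_mon => i k.
by rewrite /coords mxE mulVKf.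
Qed.

Lemma mon_piv (A : comNzRingType) (piv : forall i, 'I_(n i).+1)
    (x : forall i, 'I_(n i).+1 -> A) a :
  (forall i k, k != piv i -> expo a i k = 0%N) ->
  mon (d := d) x a = \prod_i x i (piv i) ^+ d i.
Proof.
move=> ea; apply: eq_bigr => i _.
have := expo_sum a i; rewrite (bigD1 (piv i)) //= big1 ?addn0 => [<-|k /ea //].
rewrite (bigD1 (piv i)) //= [X in _ * X]big1 ?mulr1 // => k /ea ->.
by rewrite expr0.
Qed.

(* The monomial prod_i (x^i_(piv i))^(d i) with one factor x^i0_(piv i0)
   replaced by x^i0_k0; the pure power for [k0 = piv i0]. *)
Lemma expo_neighbour (piv : forall i, 'I_(n i).+1) i0 (k0 : 'I_(n i0).+1) :
  exists a : 'I_svs, forall i k, expo a i k =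
    ((if i == i0 then (d i).-1 else d i) * (k == piv i)
     + (Tagged (fun i => 'I_(n i).+1) k == Tagged _ k0))%N.
Proof.
apply: expo_ex => i; rewrite big_split /=.
rewrite (bigD1 (piv i)) //= eqxx muln1 big1 => [|k /negbTE ->]; last by rewrite muln0.
case: eqP => [->|ne]; last first.
  rewrite addn0 big1 ?addn0 // => k _; apply/eqP; rewrite eqb0.
  by apply/negP => /eqP/(congr1 tag) /=.
rewrite (bigD1 k0) //= eqxx big1 => [|k ne]; first by have := d_gt0 i0; lia.
apply/eqP; rewrite eqb0; apply: contra ne => /eqP e.
by apply/eqP; have /eqP := e; rewrite -tag_eqE /tag_eq /= eqxx tagged_asE => /eqP.
Qed.

Lemma mon_neighbour (A : comNzRingType) (piv : forall i, 'I_(n i).+1) i0 (k0 :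
  'I_(n i0).+1)
    (x : forall i, 'I_(n i).+1 -> A) a :
  (forall i k, expo a i k = ((if i == i0 then (d i).-1 else d i) * (k == piv i)
     + (Tagged (fun i => 'I_(n i).+1) k == Tagged _ k0))%N) ->
  mon (d := d) x a = (\prod_i x i (piv i) ^+ (if i == i0 then (d i).-1 else d i)) *
    x i0 k0.
Proof.
move=> ea; rewrite /mon.
under eq_bigr => i _ do under eq_bigr => k _ do rewrite ea exprD.
under eq_bigr => i _ do rewrite big_split /=.
rewrite big_split /=; congr (_ * _).
  apply: eq_bigr => i _; rewrite (bigD1 (piv i)) //= eqxx muln1.
  by rewrite big1 ?mulr1 // => k /negbTE ->; rewrite muln0 expr0.
rewrite (sig_big_dep _ _ (fun i k => x i k ^+ (Tagged (fun i => 'I_(n i).+1) k ==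
  Tagged _ k0))) /=.
rewrite (bigD1 (Tagged _ k0)) //= eqxx expr1 big1 ?mulr1 // => -[i k] /= ne.
by rewrite (negbTE ne).
Qed.

Section At.

Variables (x : pt) (piv : forall i, 'I_(n i).+1).
Hypothesis x_piv : forall i, x i 0 (piv i) = 1.

(** The affine chart centred at x with all pivot coordinates equal to 1; [tagnat.Rank] flattens the
    pairs (factor, non-pivot coordinate) into one index. *)
Definition chart_coord i (k : 'I_(n i).+1) : {mpoly C[sv_dim n]} :=
  (x i 0 k)%:MP + (if unlift (piv i) k is Some l then 'X_(tagnat.Rank i l) else 0).

Definition chart (a : 'I_svs) : {mpoly C[sv_dim n]} := mon chart_coord a.

Lemma chart_coord_piv i : chart_coord (piv i) = 1.
Proof. by rewrite /chart_coord unlift_none addr0 x_piv. Qed.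

(** The coordinate of the neighbour monomial [col v] is the v-th variable plus a constant, because
    the pivots are 1. Hence the Jacobian contains an identity block, which N selects. *)
Lemma chart_param c : c != 0 -> local_param (SV n d) (c *: sv_map d x) chart.
Proof.
move=> c0.
have chart_eval t : pmap_at chart t =
    sv_map d (fun i => \row_k (chart_coord k).@[t]).
  apply/rowP => a; rewrite sv_mapE mxE /chart (rmorph_mon (meval t)).
  by apply: eq_mon => i k; rewrite /coords mxE.
split.
- have [a ea] := expo_neighbour piv (piv ord0); exists a.
  rewrite /chart (mon_neighbour _ ea) chart_coord_piv mulr1 big1 // => i _.
  by rewrite chart_coord_piv expr1n.
- move=> t; rewrite chart_eval; eexists; split; last by exists 1;
  rewrite oner_eq0 scale1r.
  move=> i; apply/rV0Pn; exists (piv i).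
  by rewrite mxE chart_coord_piv meval1 oner_eq0.
- exists c^-1; split; first by rewrite invr_eq0.
  rewrite scalerA mulVf // scale1r chart_eval; apply/rowP => a; rewrite !sv_mapE.
  apply: eq_mon => i k; rewrite /coords mxE /chart_coord mevalD mevalC.
  by case: (unlift _ _) => [l|]; rewrite ?mevalXU ?meval0 addr0.
- have [col Hcol] := fin_all_exists (fun v : 'I_(sv_dim n) =>
    expo_neighbour piv (lift (piv (tagnat.sig1 v)) (tagnat.sig2 v))).
  pose N : 'M[C]_(svs, sv_dim n) := \matrix_(a, v) (a == col v)%:R.
  apply/row_freeP; exists N; apply/matrixP => v v'; rewrite !mxE.
  rewrite (bigD1 (col v')) //= big1 ?addr0 => [|a ne]; last first.
    by rewrite [N _ _]mxE (negbTE ne) mulr0.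
  rewrite [N _ _]mxE eqxx mulr1 !mxE mderivmU1m /chart (mon_neighbour _ (Hcol v')).
  rewrite big1 => [|i _]; last by rewrite chart_coord_piv expr1n.
  rewrite mul1r /chart_coord liftK tagnat.sig2K mderivD mderivC add0r mderivX mevalZ.
  rewrite mnm1E; case: eqP => [->|ne]; last by rewrite mul0r; case: eqP ne => // ->.
  by rewrite eqxx mul1r mevalX big1 // => i _; rewrite mnmBE subnn expr0.
Qed.

Lemma osc_chart c e h : c != 0 ->
    hyperplane_contains h (osc_space (SV n d) (sv_dim n) e (c *: sv_map d x)) ->
  forall u, (mdeg u <= e)%N -> (\sum_a h 0 a *: chart a)@_u = 0.
Proof.
move=> c0 hosc u ue; apply/mderivm_at0.
have /matrixP/(_ 0 0) : h *m (pmap_deriv0 chart u)^T = 0.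
  apply: hosc; exists chart; split; first exact: chart_param.
  by move=> U HU; apply: HU; exists u.
rewrite !mxE => h0; rewrite -[RHS]h0 !raddf_sum; apply: eq_bigr => a _ /=.
by rewrite mderivmZ mevalZ !mxE.
Qed.

(** In the chart, h is a polynomial P without terms of degree at most e, whereas [line_form] uses an
    arbitrary line in the affine cones. Rescaling factor i by [mu i] brings the line into the chart
    modulo X^(e+1) and multiplies the form by a factor prime to X. *)
Lemma osc_vanish c e h : c != 0 ->
    hyperplane_contains h (osc_space (SV n d) (sv_dim n) e (c *: sv_map d x)) ->
  vanish e.+1 h x.
Proof.
move=> c0 hosc w; set P := \sum_a h 0 a *: chart a.
have P0 : forall u, (mdeg u <= e)%N -> P@_u = 0 by apply: osc_chart c0 hosc.
pose t i : {poly C} := (- w i 0 (piv i))%:P * 'X.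
(* The inverse of [1 - t i] modulo ['X^(e.+1)]: dividing by it brings a line
   through x back to the chart. *)
pose mu i := \sum_(j < e.+1) t i ^+ j.
have muE i : 'X^(e.+1) %| mu i * (1 - t i) - 1.
  have -> : mu i * (1 - t i) - 1 = - (t i ^+ e.+1).
    transitivity (- ((t i - 1) * mu i) - 1); first by ring.
    by rewrite -subrX1; ring.
  by rewrite dvdpNr /t exprMn dvdp_mull.
(* Chart displacement along the line: (x_k + s w_k) / (1 + s w_piv) - x_k = s (w_k - w_piv x_k) / (1
   + s w_piv). *)
pose tau (q : {i & 'I_(n i)}) := w (tag q) 0 (lift (piv (tag q)) (tagged q))
  - w (tag q) 0 (piv (tag q)) * x (tag q) 0 (lift (piv (tag q)) (tagged q)).
pose T (v : 'I_(sv_dim n)) : {poly C} :=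
  (tau (tagnat.sig v))%:P * mu (tag (tagnat.sig v)) * 'X.
pose ev : {mpoly C[sv_dim n]} -> {poly C} := mmap polyC T.
have evP : 'X^(e.+1) %| ev P.
  rewrite /ev /mmap big_seq;
    apply: (big_ind (fun p : {poly C} => is_true ('X^(e.+1) %| p))) => [||u uP];
    first exact: dvdp0.
    by move=> p q; apply: dvdp_add.
  apply: dvdp_mull; have lt : (e < mdeg u)%N.
    by rewrite ltnNge; apply: contraL uP => /P0 /eqP; rewrite mcoeff_eq0.
  rewrite /mmap1 /T; under eq_bigr do rewrite exprMn.
  rewrite big_split /= dvdp_mull // prodrXr -mdegE.
  by rewrite dvdp_exp2l.
pose z i k : {poly C} := (x i 0 k)%:P + (w i 0 k)%:P * 'X.
have zc i k : 'X^(e.+1) %| mu i * z i k - ev (chart_coord k).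
  rewrite /ev /chart_coord rmorphD /= mmapC.
  have [l ->|->] := unliftP (piv i) k; last first.
    rewrite rmorph0 addr0 x_piv.
    have -> : z i (piv i) = 1 - t i by rewrite /z /t x_piv polyCN; ring.
    exact: muE.
  rewrite mmapX mmap1U /T /tagnat.Rank tagnat.rankK /=.
  have -> : mu i * z i (lift (piv i) l) - ((x i 0 (lift (piv i) l))%:P +
     (tau (Tagged (fun i => 'I_(n i)) l))%:P * mu i * 'X) =
     (x i 0 (lift (piv i) l))%:P * (mu i * (1 - t i) - 1).
    by rewrite /z /t /tau /= polyCN polyCB polyCM; ring.
  by rewrite dvdp_mull.
have evE : ev P = \sum_a (h 0 a)%:P * mon (fun i k => ev (chart_coord k)) a.
  rewrite /P /ev raddf_sum; apply: eq_bigr => a _ /=.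
  by rewrite mmapZ /chart (rmorph_mon (mmap polyC T)).
have : 'X^(e.+1) %| \prod_i mu i ^+ d i * line_form h x w.
  rewrite -[_ * _](subrK (ev P)) dvdp_add // evE mulr_sumr -sumrB.
  apply: (big_ind (fun p : {poly C} => is_true ('X^(e.+1) %| p))) => [||a _];
    first exact: dvdp0; first by move=> p q; apply: dvdp_add.
  by rewrite mulrCA -mon_scale -mulrBr dvdp_mull // dvdp_sub_mon.
rewrite Gauss_dvdpr //; apply: coprimep_expl; rewrite coprimep_sym.
rewrite -[X in coprimep _ X]subr0 -polyC0 coprimep_XsubC rootE.
rewrite horner_prod; apply/prodf_neq0 => i _; rewrite horner_exp expf_neq0 //.
rewrite /mu big_ord_recl expr0 hornerD hornerC horner_sum big1 ?addr0 ?oner_eq0 //.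
by move=> j _; rewrite /t horner_exp hornerM hornerX mulr0 expr0n.
Qed.

End At.
End Chart.

Lemma dvdp_Xn_coef (F : fieldType) e (p : {poly F}) k :
  'X^e %| p -> (k < e)%N -> p`_k = 0.
Proof. by move=> /dvdpP[q ->] ke; rewrite coefMXn ke. Qed.

Definition ord_ge (R : comNzRingType) k e (p : {mpoly R[k]}) : Prop :=
  forall u, (mdeg u < e)%N -> p@_u = 0.

Lemma ord_geM (R : comNzRingType) k a b (p q : {mpoly R[k]}) :
  ord_ge a p -> ord_ge b q -> ord_ge (a + b) (p * q).
Proof.
move=> pa qb m ltm; rewrite mcoeffM big1 // => -[k1 k2] /= /eqP em.
have {}ltm : (mdeg k1 + mdeg k2 < a + b)%N by rewrite -mdegD -em.
case: (ltnP (mdeg k1) a) => [/pa ->|le1]; first by rewrite mul0r.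
by rewrite (qb k2) ?mulr0 //; lia.
Qed.

Lemma ord_geX (R : comNzRingType) k (p : {mpoly R[k]}) e :
  ord_ge 1 p -> ord_ge e (p ^+ e).
Proof.
by move=> p1; elim: e => [|e IH] //; rewrite exprS -add1n; apply: ord_geM.
Qed.

(** A polynomial with nonzero constant term is a unit of the local ring at 0; the induction runs on
    the degree of the coefficient. *)
Lemma ord_ge_cancel (F : fieldType) k e (p q : {mpoly F[k]}) :
  q@_0%MM != 0 -> ord_ge e (p * q) -> ord_ge e p.
Proof.
move=> q0 pq u; move: {2}(mdeg u).+1 (ltnSn (mdeg u)) => l.
elim: l u => // l IH u; rewrite ltnS => ul ue; have := pq _ ue.
rewrite mcoeffM (bigD1 (BMultinom (leqnn (mdeg u).+1), bm0)) /= ?addm0 //.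
rewrite big1 => [|[k1 k2] /= /andP[/eqP eu ne]].
  by move/eqP; rewrite addr0 mulf_eq0 (negbTE q0) orbF => /eqP.
have dk : mdeg u = (mdeg k1 + mdeg k2)%N by rewrite -mdegD -eu.
have k20 : mdeg k2 != 0%N.
  apply: contra ne; rewrite mdeg_eq0 => /eqP k20; apply/eqP.
  by congr (_, _); apply/val_inj; rewrite /= ?k20 // [RHS]eu k20 addm0.
by rewrite IH ?mul0r //; lia.
Qed.

(** * Osculation at a coordinate point *)

Section Order.

Variables (r : nat) (n d : 'I_r.+1 -> nat) (C : numClosedFieldType).
Notation svs := (sv_size n d).
Notation pt := (forall i, 'rV[C]_(n i).+1).
Hypothesis d_gt0 : forall i, (0 < d i)%N.
Local Notation tagk k := (Tagged (fun i => 'I_(n i).+1) k).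
Variable piv : forall i, 'I_(n i).+1.

Definition coord_pt : pt := fun i => delta_mx 0 (piv i).

(* The order of vanishing of the monomial a at [coord_pt]. *)
Definition codeg (a : 'I_svs) : nat := (\sum_i \sum_(k | k != piv i) expo a i k)%N.

Lemma codegE a : (\sum_i expo a i (piv i) + codeg a = \sum_i d i)%N.
Proof.
rewrite /codeg -big_split; apply: eq_bigr => i _ /=.
by rewrite -(expo_sum a i) [in RHS](bigD1 (piv i)).
Qed.

(** For a direction w without pivot components, the monomial a restricts to s^(codeg a) times a
    monomial in w, and distinct a give distinct monomials because the exponent sums of each factor
    are fixed. So the coefficient of s^(codeg a0) is a combination of independent monomials. *)
Lemma vanish_coord_pt e (h : 'rV[C]_svs) a0 :
  vanish e h coord_pt -> (codeg a0 < e)%N -> h 0 a0 = 0.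
Proof.
move=> vh lt; pose c a := if codeg a == codeg a0 then h 0 a else 0.
suff c0 : forall a, c a = 0 by have := c0 a0; rewrite /c eqxx.
pose E (a : 'I_svs) (q : {i : 'I_r.+1 & 'I_(n i).+1}) :=
  if tagged q == piv (tag q) then 0%N else expo a (tag q) (tagged q).
apply: (@monomials_free C _ _ E c) => [a b eab|y].
  have eab' i k : k != piv i -> expo a i k = expo b i k.
    by move=> /negbTE ne; have := eab (tagk k); rewrite /E /= ne.
  apply: expo_inj => i k; have [->|] := eqVneq k (piv i); last exact: eab'.
  have := expo_sum a i; rewrite -(expo_sum b i) !(bigD1 (piv i) (P := predT)) //=.
  by rewrite [X in (_ + X)%N = _](eq_bigr _ (eab' i)) => /addIn.
pose w : pt := fun i => \row_k (if k == piv i then 0 else y (tagk k)).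
have monE a : mon (fun i k => (coord_pt i 0 k)%:P + (w i 0 k)%:P * 'X) a
    = (\prod_q y q ^+ E a q)%:P * 'X^(codeg a) :> {poly C}.
  have -> : \prod_q y q ^+ E a q = \prod_i \prod_(k | k != piv i) y (tagk k) ^+
    expo a i k.
    transitivity (\prod_i \prod_(k < (n i).+1) y (tagk k) ^+ E a (tagk k)).
      rewrite (sig_big_dep _ _ (fun i (k : 'I_(n i).+1) => y (tagk k) ^+ E a (tagk
        k))) /=.
      by apply: eq_bigr => -[i k].
    apply: eq_bigr => i _; rewrite (bigD1 (piv i)) //= /E /= eqxx expr0 mul1r.
    by apply: eq_bigr => k /negbTE ->.
  rewrite /codeg -prodrXr rmorph_prod -big_split; apply: eq_bigr => i _ /=.
  rewrite (bigD1 (piv i)) //= !mxE !eqxx mul0r addr0 expr1n mul1r.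
  rewrite -prodrXr rmorph_prod -big_split; apply: eq_bigr => k /negbTE ne /=.
  by rewrite !mxE ne andbF add0r exprMn polyC_exp.
have := dvdp_Xn_coef (vh w) lt.
rewrite /line_form coef_sum => eq0; rewrite -[RHS]eq0; apply: eq_bigr => a _.
rewrite monE mulrA -polyCM coefCM coefXn /c eq_sym.
by case: eqP => _; rewrite ?mulr1 ?mulr0 ?mul0r.
Qed.

Lemma lin_span_hyperplane m (h : 'rV[C]_m) S :
  hyperplane_contains h S -> hyperplane_contains h (lin_span S).
Proof.
move=> hS w wS; have lin v : in_hyperplane h v <-> v \in lker (linfun (mulmxr h^T)).
  rewrite memv_ker lfunE /= /in_hyperplane; split=> [hv|/eqP vh].
    by rewrite -[v]trmxK -trmx_mul hv trmx0.
  by rewrite -[h]trmxK -trmx_mul vh trmx0.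
by apply/lin/wS => v Sv; apply/lin/hS.
Qed.

(* On the variety, [z_m * z_a0 ^ codeg m = z_a0 * \prod z_nb ^ expo m], where a0
   is the pure power and the neighbours nb of a0 vanish at [coord_pt]; so z_m has
   order at least [codeg m] along every parametrization. *)
Lemma osc_order c e (h : 'rV[C]_svs) (g : forall i, 'M[C]_((n i).+1)) (G :
  'M[C]_svs) (x : pt) :
    c != 0 -> (forall x : pt, sv_map d (act g x) = sv_map d x *m G) ->
    act g x = coord_pt ->
    (forall a, h 0 a != 0 -> (e < codeg a)%N) ->
  hyperplane_contains (h *m G^T) (osc_space (SV n d) (sv_dim n) e (c *: sv_map d x)).
Proof.
move=> c0 gG gx hsupp w [phi [[_ phiSV [c1 [c10 phi0]] _]] wphi].
apply: lin_span_hyperplane wphi => {w} _ [u [ue ->]].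
(* The parametrization in the moved frame, where its value at 0 is proportional to the image of
   [coord_pt]. *)
pose psi m := \sum_a G a m *: phi a.
have psiE t m : (psi m).@[t] = (pmap_at phi t *m G) 0 m.
  rewrite mxE raddf_sum; apply: eq_bigr => a _ /=.
  by rewrite mevalZ mxE mulrC.
have psiSV t : exists c2 (z : pt), forall m, (psi m).@[t] = c2 * mon (coords z) m.
  have [y [_ [c2 [_ e2]]]] := phiSV t; exists c2, (act g y) => m.
  by rewrite psiE e2 -scalemxAl -gG mxE sv_mapE.
have psi0 m : (psi m)@_0%MM = c1 * c * mon (coords coord_pt) m.
  by rewrite -meval_at0 psiE phi0 scalerA -scalemxAl -gG mxE sv_mapE gx.
have [a0 Ha0] := expo_neighbour d_gt0 piv (piv ord0).
have {Ha0}mon0 z : mon (coords z) a0 = \prod_i (z : pt) i 0 (piv i) ^+ d i.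
  apply: mon_piv => i k ne; rewrite Ha0 (negbTE ne) muln0 add0n.
  apply/eqP; rewrite eqb0; apply: contra ne => /eqP e1.
  have := congr1 (fun q : {i : 'I_r.+1 & 'I_(n i).+1} => tagged q == piv (tag q)) e1.
  by rewrite /= eqxx => ->.
have [nb Hnb] := fin_all_exists (fun q : {i : 'I_r.+1 & 'I_(n i).+1} =>
   expo_neighbour d_gt0 piv (tagged q)).
have psi_ord m : ord_ge (codeg m) (psi m).
  have rel : psi m * psi a0 ^+ codeg m = psi a0 *
      \prod_i \prod_(k | k != piv i) psi (nb (tagk k)) ^+ expo m i k.
    apply/eqP; rewrite -subr_eq0; apply/eqP/mpoly_fun0 => t.
    rewrite mevalB !mevalM (rmorphXn (meval t)) (rmorph_prod (meval t)) /=.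
    have [c2 [z Hz]] := psiSV t.
    under eq_bigr => i _ do rewrite (rmorph_prod (meval t)) /=.
    under eq_bigr => i _ do under eq_bigr => k _ do rewrite rmorphXn /= Hz
      (mon_neighbour _ (Hnb _)) /= -/(coords _ _).
    rewrite !Hz mon0.
    pose s i := (\sum_(k | k != piv i) expo m i k)%N.
    pose P := \prod_i z i 0 (piv i) ^+ d i.
    pose Nb i := \prod_j coords z (piv j) ^+ (if j == i then (d j).-1 else d j).
    have PN i : P = Nb i * z i 0 (piv i).
      rewrite /P /Nb (bigD1 i) //= [in RHS](bigD1 i) //= eqxx mulrAC -exprSr prednK //.
      by congr (_ * _); apply: eq_bigr => j /negbTE ->.
    have -> : \prod_i \prod_(k | k != piv i) (c2 * (Nb i * coords z k)) ^+ expo m i k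
       = \prod_i (c2 ^+ s i * Nb i ^+ s i * \prod_(k | k != piv i) z i 0 k ^+ expo
         m i k).
      apply: eq_bigr => i _; rewrite /s -!prodrXr -!big_split; apply: eq_bigr => k _ /=.
      by rewrite !exprMn mulrA.
    rewrite -/P /codeg -/s -prodrXr /mon.
    apply/eqP; rewrite subr_eq0; apply/eqP.
    rewrite -[LHS]mulrA -[RHS]mulrA; congr (_ * _).
    have Pdef : P = \prod_i z i 0 (piv i) ^+ d i by [].
    rewrite [X in _ = X * _]Pdef -!big_split; apply: eq_bigr => i _ /=.
    rewrite (bigD1 (piv i)) //= exprMn (PN i) [in LHS]exprMn -/s.
    have -> : d i = (expo m i (piv i) + s i)%N.
      by rewrite -(expo_sum m i) (bigD1 (piv i)).
    rewrite exprD /coords -/(s i) -!mulrA; congr (_ * _).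
    by rewrite mulrC !mulrA; congr (_ * _); rewrite mulrC mulrA.
  apply: (@ord_ge_cancel _ _ _ _ (psi a0 ^+ codeg m)).
    rewrite -meval_at0 rmorphXn /= expf_neq0 // meval_at0 psi0 mon0 !mulf_neq0 //.
    by apply/prodf_neq0 => i _; rewrite mxE !eqxx expr1n oner_eq0.
  rewrite rel -[codeg m]add0n; apply: ord_geM => //.
  rewrite /codeg; elim/big_rec2: _ => // i p s _ IH; apply: ord_geM IH.
  elim/big_rec2: _ => // k p' s' ne IH; apply: ord_geM IH; apply: ord_geX => v.
  rewrite ltnS leqn0 mdeg_eq0 => /eqP ->.
  rewrite psi0 (mon_neighbour _ (Hnb _)) /= /coords !mxE eqxx /= (negbTE ne).
  by rewrite !mulr0.
rewrite /in_hyperplane -mulmxA -trmx_mul; apply/matrixP => i j; rewrite !ord1 !mxE.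
rewrite big1 // => m _; have [->|/hsupp em] := eqVneq (h 0 m) 0; first by rewrite mul0r.
have psim : (psi m)^`M[u].@[fun=> 0] = 0.
  by apply/mderivm_at0/psi_ord; apply: leq_ltn_trans em.
rewrite !mxE [X in _ * X](_ : _ = 0) ?mulr0 // -[RHS]psim.
rewrite /psi !raddf_sum; apply: eq_bigr => a _ /=.
by rewrite mderivmZ mevalZ !mxE mulrC.
Qed.

End Order.

(** * Singularities of general forms *)

Lemma coef1_expDX (F : comNzRingType) e : ((1 + 'X : {poly F}) ^+ e)`_1 = e%:R.
Proof.
have c0 k : ((1 + 'X : {poly F}) ^+ k)`_0 = 1.
  by rewrite -horner_coef0 horner_exp !hornerE expr1n.
elim: e => [|e IH]; first by rewrite expr0 coefC.
by rewrite exprS mulrDl mul1r coefD coefXM /= IH c0 -natr1.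
Qed.

Section Generic.

Variables (r : nat) (n d : 'I_r.+1 -> nat) (C : numClosedFieldType).
Notation svs := (sv_size n d).
Notation pt := (forall i, 'rV[C]_(n i).+1).
Local Notation tagk k := (Tagged (fun i => 'I_(n i).+1) k).
Local Notation Q := {i : 'I_r.+1 & 'I_(n i).+1}.
Hypothesis d_gt0 : forall i, (0 < d i)%N.
Hypothesis n_mono : forall i, (n ord0 <= n i)%N.
Hypothesis d_gap : forall i, i != ord0 -> (d ord0 + 2 <= d i)%N.

(** The points (emb i j)_i are the coordinate points e_j; [n_mono] keeps [inord] away from its
    default value. *)
Definition emb i (j : 'I_(n ord0).+1) : 'I_(n i).+1 := inord j.

Lemma val_emb i j : emb i j = j :> nat.
Proof. by rewrite inordK // (leq_trans (ltn_ord j)) // ltnS n_mono. Qed.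

Lemma emb_inj i : injective (emb i).
Proof. by move=> j j' e; apply/val_inj; rewrite /= -(val_emb i j) e val_emb. Qed.

Lemma emb0 j : emb ord0 j = j.
Proof. by apply/val_inj; rewrite /= val_emb. Qed.

Definition allowed (a : 'I_svs) : bool :=
  [forall j, (d ord0 < codeg (fun i => emb i j) a)%N].

Lemma allowedP a :
  reflect (forall j, (\sum_i expo a i (emb i j) + d ord0 < \sum_i d i)%N) (allowed a).
Proof.
apply: (iffP forallP) => H j; have := H j.
  by have := codegE (fun i => emb i j) a; lia.
by have := codegE (fun i => emb i j) a; lia.
Qed.

Lemma eq_tagk i (k k' : 'I_(n i).+1) : (tagk k == tagk k') = (k == k').
Proof.
apply/eqP/eqP => [e|->//]; apply/eqP.
have := congr1 (fun q : Q => tagged_as (tagk k') q == k') e.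
by rewrite !tagged_asE eqxx => ->.
Qed.

Lemma neq_tagk i i' (k : 'I_(n i).+1) (k' : 'I_(n i').+1) :
  i != i' -> (tagk k == tagk k') = false.
Proof. by move=> ne; apply/negbTE; apply: contra ne => /eqP/(congr1 tag)/= ->. Qed.

Lemma sum_delta (T : finType) (t : T) (c : nat) : (\sum_s c * (s == t) = c)%N.
Proof.
rewrite (bigD1 t) //= eqxx muln1 big1 ?addn0 // => s /negbTE ->.
by rewrite muln0.
Qed.

(** If a factor i1 > 1 supports two coordinates k1 and k2, give them exponents d_1 + 1 and d_i1 -
    d_1 - 1 >= 1. The codegree then exceeds d_1 already within i1, except possibly at e_k1, where i1
    contributes at least 1 and the first factor, sitting at another index, the missing d_1.
    Otherwise every factor i > 1 supports a single coordinate, and for each j some pure power away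
    from e_j contributes d_i > d_1. *)
Lemma allowed_ex (S : forall i, pred 'I_(n i).+1) :
    (forall i, exists k, S i k) ->
    (forall j, exists i (k : 'I_(n i).+1), [/\ i != ord0, k != emb i j & S i k]) ->
  exists2 a, allowed a & forall i k, ~~ S i k -> expo a i k = 0%N.
Proof.
move=> Sne Soff; have [s Hs] := fin_all_exists Sne.
have [] := boolP [exists q : Q, (tag q != ord0) && S (tag q) (tagged q) &&
    [exists k, (k != tagged q) && S (tag q) k]].
  move=> /existsP[[i1 k1] /= /andP[/andP[i10 Sk1] /existsP[k2 /andP[k12 Sk2]]]].
  (* As k1 and k2 differ, at least one of them is not the index used in the first factor. *)
  wlog ne0 : k1 k2 Sk1 Sk2 k12 / k1 != s ord0 :> nat.
    move=> H; have [e|] := eqVneq (k1 : nat) (s ord0); last exact: (H k1 k2).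
    apply: (H k2 k1) => //; first by rewrite eq_sym.
    by rewrite -e; apply: contra k12 => /eqP e2; apply/eqP/val_inj.
  pose ee i (k : 'I_(n i).+1) := ((d ord0 + 1) * (tagk k == tagk k1) +
      (d i - (d ord0 + 1)) * (tagk k == tagk k2) + (i != i1) * d i * (k == s i))%N.
  have [a Ha] : exists a : 'I_svs, forall i k, expo a i k = ee i k.
    apply: expo_ex => i; rewrite !big_split /= sum_delta.
    have [->|ne] := eqVneq i i1; rewrite ?mul1n ?mul0n ?addn0.
      under eq_bigr do rewrite eq_tagk;
        under [X in (_ + X)%N]eq_bigr do rewrite eq_tagk.
      by rewrite !sum_delta; have := d_gap i10; lia.
    by rewrite !big1 // => k _; rewrite neq_tagk // muln0.
  exists a; last first.
    move=> i; case: (eqVneq i i1) => [->|ne] k nS; rewrite Ha /ee.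
      rewrite eqxx !eq_tagk addn0.
      have [e|_] := eqVneq k k1; first by rewrite e Sk1 in nS.
      by have [e|_] := eqVneq k k2; [rewrite e Sk2 in nS | rewrite !muln0].
    rewrite !neq_tagk // !muln0.
    by have [e|_] := eqVneq k (s i); [rewrite e Hs in nS | rewrite muln0].
  apply/allowedP => j.
  rewrite (bigD1 ord0) //= (bigD1 i1) //= [X in (_ < X)%N](bigD1 ord0) //= [X in (_
    < _ + X)%N](bigD1 i1) //=.
  have -> : (\sum_(i | (i != ord0) && (i != i1)) expo a i (emb i j) =
     \sum_(i | (i != ord0) && (i != i1)) d i * (emb i j == s i))%N.
    by apply: eq_bigr => i /andP[_ ne]; rewrite Ha /ee ne !neq_tagk // !muln0 mul1n.
  have le : (\sum_(i | (i != ord0) && (i != i1)) d i * (emb i j == s i) <=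
     \sum_(i | (i != ord0) && (i != i1)) d i)%N.
    by apply: leq_sum => i _; case: eqP; lia.
  rewrite !Ha /ee eqxx !eq_tagk ![tagk (emb ord0 j) == _]neq_tagk 1?eq_sym // i10
    -!val_eqE /= !val_emb.
  move: k12 ne0; rewrite -val_eqE /=; have := d_gap i10; move: le.
  case: (eqVneq (j : nat) k1); case: (eqVneq (j : nat) k2);
    case: (eqVneq (j : nat) (s ord0)) => /=; lia.
rewrite negb_exists => /forallP uniqS.
have us i k : i != ord0 -> S i k -> k = s i.
  move=> i0 Sk; have := uniqS (tagk (s i)); rewrite /= i0 Hs /= negb_exists.
  by move/forallP/(_ k); rewrite Sk andbT negbK => /eqP.
have [a Ha] := @expo_ex _ n d (fun i k => d i * (k == s i))%N (fun i => sum_delta _ _).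
exists a; last first.
  by move=> i k; rewrite Ha; case: eqP => [->|]; rewrite ?Hs ?muln0.
apply/allowedP => j; have [i1 [k [i10 kj Sk]]] := Soff j.
rewrite (bigD1 ord0) //= (bigD1 i1) //= [X in (_ < X)%N](bigD1 ord0) //= [X in (_ <
  _ + X)%N](bigD1 i1) //=.
have le : (\sum_(i | (i != ord0) && (i != i1)) expo a i (emb i j) <=
   \sum_(i | (i != ord0) && (i != i1)) d i)%N.
  by apply: leq_sum => i _; rewrite Ha; case: eqP; lia.
rewrite !Ha -(us _ _ i10 Sk) [emb i1 j == k]eq_sym (negbTE kj).
move: le; rewrite muln0; have := d_gap i10.
set u := (\sum_(i | _) expo a i (emb i j))%N; set v := (\sum_(i | _) d i)%N.
by case: eqP => _; rewrite ?muln1 ?muln0; clearbody u v; lia.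
Qed.

(** This is the logarithmic derivative x d/dx: the direction w keeps the coordinate itself, so every
    term is weighted by its exponent and no division occurs. *)
Lemma vanish_log (h : 'rV[C]_svs) (y : pt) i0 (k0 : 'I_(n i0).+1) :
  vanish 2 h y ->
  \sum_a h 0 a * mon (coords y) a * (expo a i0 k0)%:R = 0.
Proof.
move=> vh; pose w : pt := fun i => \row_k (if tagk k == tagk k0 then y i 0 k else 0).
have := dvdp_Xn_coef (vh w) (ltnSn 1).
rewrite /line_form coef_sum => eq0; rewrite -[RHS]eq0; apply: eq_bigr => a _.
have -> : mon (fun i k => (y i 0 k)%:P + (w i 0 k)%:P * 'X) a =
   (mon (coords y) a)%:P * (1 + 'X) ^+ expo a i0 k0 :> {poly C}.
  rewrite (rmorph_mon polyC) !mon_sig (bigD1 (tagk k0)) //= [in RHS](bigD1 (tagk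
    k0)) //=.
  rewrite mulrAC -exprMn mxE eqxx mulrDr mulr1; congr (_ * _).
  apply: eq_bigr => -[i k] /= ne; rewrite mxE.
  by have -> : (tagk k == tagk k0) = false by [apply/negbTE]; rewrite mul0r addr0.
by rewrite coefCM coefCM coef1_expDX mulrA.
Qed.

(** The partial derivative in a coordinate that vanishes at y only sees the monomials linear in
    it. *)
Lemma vanish_dir (h : 'rV[C]_svs) (y : pt) i0 (k0 : 'I_(n i0).+1) :
  vanish 2 h y -> y i0 0 k0 = 0 ->
  \sum_(a | expo a i0 k0 == 1%N) h 0 a * \prod_(q : Q | q != tagk k0)
     y (tag q) 0 (tagged q) ^+ expo a (tag q) (tagged q) = 0.
Proof.
move=> vh y0; pose w : pt := fun i => \row_k (tagk k == tagk k0)%:R.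
have := dvdp_Xn_coef (vh w) (ltnSn 1).
rewrite /line_form coef_sum => eq0; rewrite -[RHS]eq0 big_mkcond; apply: eq_bigr => a _.
have -> : mon (fun i k => (y i 0 k)%:P + (w i 0 k)%:P * 'X) a =
   (\prod_(q : Q | q != tagk k0) y (tag q) 0 (tagged q) ^+ expo a (tag q) (tagged q))%:P
    * 'X ^+ expo a i0 k0 :> {poly C}.
  rewrite mon_sig (bigD1 (tagk k0)) //= mulrC mxE eqxx y0 add0r mul1r.
  congr (_ * _); rewrite rmorph_prod; apply: eq_bigr => -[i k] /= ne; rewrite mxE.
  by have -> : (tagk k == tagk k0) = false by [apply/negbTE];
    rewrite mul0r addr0 rmorphXn.
rewrite coefCM coefCM coefXn eq_sym.
by case: eqP => _; rewrite ?mulr1 ?mulr0.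
Qed.

End Generic.

Lemma thin_False (C : numFieldType) N (B : ('I_N -> C) -> Prop) :
  (forall c, ~ B c) -> thin B.
Proof. by move=> nB; exists 1; [rewrite oner_eq0 | move=> c /nB]. Qed.

Lemma sum_delta1 (T : finType) (t : T) : (\sum_s (s == t) = 1)%N.
Proof. by rewrite -[RHS](sum_delta t 1); apply: eq_bigr => s _; rewrite mul1n. Qed.

Section Generic.

Variables (r : nat) (n d : 'I_r.+1 -> nat) (C : numClosedFieldType).
Notation svs := (sv_size n d).
Notation pt := (forall i, 'rV[C]_(n i).+1).
Local Notation tagk k := (Tagged (fun i => 'I_(n i).+1) k).
Local Notation Q := {i : 'I_r.+1 & 'I_(n i).+1}.
Hypothesis d_gt0 : forall i, (0 < d i)%N.
Hypothesis n_mono : forall i, (n ord0 <= n i)%N.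
Hypothesis d_gap : forall i, i != ord0 -> (d ord0 + 2 <= d i)%N.

Local Notation N := #|@allowed r n d|.
Local Notation alpha := (@enum_val _ (@allowed r n d)).
Local Notation emb := (@emb r n).

(** Genericity is relative to the hyperplanes through T, so thinness is measured in the space of
    allowed coefficients alone. *)
Definition allowed_form (c : 'I_N -> C) (h : 'rV[C]_svs) : Prop :=
  (forall a, ~~ allowed a -> h 0 a = 0) /\ (forall i, c i = h 0 (alpha i)).

Lemma allowed_form_sum c h (P : pred 'I_svs) (F : 'I_svs -> C) : allowed_form c h ->
  \sum_(a | P a) h 0 a * F a = \sum_(i | P (alpha i)) c i * F (alpha i).
Proof.
move=> [h0 ch]; rewrite [LHS]big_mkcond [RHS]big_mkcond /=.
rewrite (bigID (@allowed r n d)) /= [X in _ + X]big1 ?addr0 => [|a na]; last first.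
  by rewrite h0 // mul0r if_same.
rewrite [LHS](big_enum_val (A := @allowed r n d)); apply: eq_bigr => i _.
by rewrite ch.
Qed.

(** For a fixed support S, only the monomials supported in S contribute to the logarithmic
    derivatives, which reduces to the torus; [thin_comp] lets the other coefficients be arbitrary.
    The required allowed monomial ensures that at least one coefficient is constrained. *)
Lemma toric_sing_thin (S : {set Q}) :
  thin (fun c : 'I_N -> C => exists h (y : pt),
    [/\ allowed_form c h, vanish 2 h y,
        forall q : Q, (y (tag q) 0 (tagged q) != 0) = (q \in S)
      & exists2 a : 'I_svs, allowed a &
          forall q : Q, q \notin S -> expo a (tag q) (tagged q) = 0%N]).
Proof.
pose T := [pred i : 'I_N | [forall q : Q, (q \notin S) ==>
  (expo (alpha i) (tag q) (tagged q) == 0%N)]].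
case: (posnP #|T|) => [T0|T0].
  apply: thin_False => c [h [y [_ _ _ [a Aa aS]]]].
  have := card0_eq T0 (enum_rank_in Aa a); rewrite !inE enum_rankK_in //.
  by move/negP; apply; apply/forallP => q; apply/implyP => /aS ->.
pose iota : 'I_#|T| -> 'I_N := @enum_val _ T.
pose E (i : 'I_#|T|) (q : Q) := expo (alpha (iota i)) (tag q) (tagged q).
have Edeg i : (\sum_q E i q = \sum_i d i)%N.
  rewrite -(eq_bigr _ (fun i' _ => expo_sum (alpha (iota i)) i')).
  by rewrite (sig_big_dep _ _ (fun i' k => expo (alpha (iota i)) i' k)).
have D0 : (0 < \sum_i d i)%N.
  by rewrite (bigD1 ord0) //= addn_gt0 d_gt0.
apply: thinS (thin_comp (@enum_val_inj _ T) (toric_thin C T0 D0 Edeg)).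
move=> c [h [y [ch vh yS _]]].
(* The value 1 off S gives a point of the torus and is harmless: these coordinates do not occur in
   the monomials of T. *)
exists (fun q => if q \in S then y (tag q) 0 (tagged q) else 1); split=> [q|q].
  by case: ifP => [qS|_]; rewrite ?oner_eq0 // yS.
have := vanish_log (tagged q) vh.
under eq_bigr do rewrite -mulrA; rewrite (allowed_form_sum _ _ ch).
rewrite (bigID T) /= [X in _ + X]big1 ?addr0 => [|i nT]; last first.
  move: nT; rewrite negb_forall => /existsP[l]; rewrite negb_imply => /andP[lS le].
  rewrite mon_sig (bigD1 l) //= /coords.
  have /eqP -> : y (tag l) 0 (tagged l) == 0 by rewrite -[_ == _]negbK yS.
  by rewrite expr0n (negbTE le) !mul0r mulr0.
rewrite (big_enum_val (A := T)) => eq0; rewrite -[RHS]eq0; apply: eq_bigr => i _ /=.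
rewrite -mulrA mon_sig; congr (_ * (_ * _)); apply: eq_bigr => l _.
case: ifP => // lS; have := enum_valP i; rewrite inE => /forallP/(_ l).
by rewrite lS /= => /eqP e; rewrite /E /iota /= e !expr0.
Qed.

(** Differentiating along x^i1_k for k <> j gives, up to a nonzero constant, a form of degree d_1 in
    the x^0_l with l <> j. Letting k run over the indices of the first factor yields as many forms
    as unknowns. Different k involve disjoint sets [A k] of coefficients, so the forms are
    independent of each other, and [s k] provides a coefficient of the pure power of x^0_l0 to solve
    for. *)
Lemma base_sing_thin (i1 : 'I_r.+1) (j l0 : 'I_(n ord0).+1) : i1 != ord0 ->
  thin (fun c : 'I_N -> C => exists h (y : pt),
    [/\ allowed_form c h, vanish 2 h y, l0 != j, y ord0 0 l0 != 0
      & forall i, i != ord0 -> y i 0 (emb i j) != 0 /\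
          forall k : 'I_(n i).+1, k != emb i j -> y i 0 k = 0]).
Proof.
move=> i10; have [->|l0j] := eqVneq l0 j.
  by apply: thin_False => c [h [y [_ _]]].
pose K : finType := {k : 'I_(n ord0).+1 | k != j}.
pose k1 (k : K) : 'I_(n i1).+1 := emb i1 (val k).
have k1j k : k1 k != emb i1 j by rewrite (inj_eq (emb_inj n_mono (i := i1))) (valP k).
pose A (k : K) : pred 'I_N := fun i => (expo (alpha i) i1 (k1 k) == 1%N) &&
  [forall q : Q, [&& tag q != ord0, tagged q != emb (tag q) j & q != tagk (k1 k)] ==>
     (expo (alpha i) (tag q) (tagged q) == 0%N)].
pose dd i := if i == i1 then (d i).-1 else d i.
have Aexp k i : A k i -> forall i', i' != ord0 -> expo (alpha i) i' (emb i' j) = dd i'.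
  move=> /andP[/eqP e1 /forallP e0] i' i'0.
  have := expo_sum (alpha i) i'; rewrite (bigD1 (emb i' j)) //= /dd.
  case: eqVneq => [e|ne].
    rewrite {i'}e in i'0 *; rewrite (bigD1 (k1 k)) //= e1 big1 => [|k' /andP[k'j k'k]].
      by rewrite addn0 addn1 => <-.
    by have := e0 (tagk k'); rewrite /= i10 k'j eq_tagk k'k => /eqP.
  rewrite big1 ?addn0 // => k' k'j.
  by have := e0 (tagk k'); rewrite /= i'0 k'j neq_tagk // => /eqP.
(* The factors i > 0 already have total exponent one less than maximal at e_j; being allowed at e_j
   leaves no room for x^0_j. *)
have A0 k i : A k i -> expo (alpha i) ord0 j = 0%N.
  move=> Aki; have /allowedP/(_ j) : allowed (alpha i) := enum_valP i.
  rewrite (bigD1 ord0) //= (bigD1 i1) //= [X in (_ < X)%N](bigD1 ord0) //= [X in (_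
    < _ + X)%N](bigD1 i1) //=.
  rewrite (Aexp k i Aki i1 i10) emb0 //.
  have -> : (\sum_(i' | (i' != ord0) && (i' != i1)) expo (alpha i) i' (emb i' j) =
    \sum_(i' | (i' != ord0) && (i' != i1)) d i')%N.
    by apply: eq_bigr => i' /andP[i'0 /negbTE ne]; rewrite (Aexp k) // /dd ne.
  rewrite /dd eqxx; have := d_gt0 i1.
  by move: (expo _ _ _) (\sum_(_ | _) _)%N => u v; lia.
have ex_s (k : K) : exists i : 'I_N, A k i /\
    forall l : K, val l != l0 -> expo (alpha i) ord0 (val l) = 0%N.
  (* The monomial with x^0_l0 to the power d_1. Its codegree is exactly d_1 + 1 at e_j, and at e_l0
     it is at least d_i1 - 1 > d_1 by the gap. *)
  pose e i (q : 'I_(n i).+1) := ((if i == ord0 then 0 else dd i) * (q == emb i j)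
     + d ord0 * (tagk q == tagk l0) + (tagk q == tagk (k1 k)))%N.
  have [a Ha] : exists a : 'I_svs, forall i q, expo a i q = e i q.
    apply: expo_ex => i; rewrite !big_split /= sum_delta.
    have [->|i0] := eqVneq i ord0.
      under eq_bigr do rewrite eq_tagk; rewrite sum_delta.
      by rewrite [X in (_ + X)%N]big1 ?addn0 // => q _; rewrite neq_tagk // eq_sym.
    rewrite [X in (_ + X + _)%N]big1 ?addn0 => [|q _]; last by rewrite neq_tagk ?muln0.
    rewrite /dd; have [->|ne] := eqVneq i i1.
      under eq_bigr do rewrite eq_tagk; rewrite sum_delta1.
      by rewrite addn1 prednK.
    by rewrite big1 ?addn0 // => q _; rewrite neq_tagk.
  have Aa : allowed a.
    apply/allowedP => j'.
    rewrite (bigD1 ord0) //= (bigD1 i1) //= [X in (_ < X)%N](bigD1 ord0) //= [X in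
      (_ < _ + X)%N](bigD1 i1) //=.
    have le : (\sum_(i | (i != ord0) && (i != i1)) expo a i (emb i j') <=
       \sum_(i | (i != ord0) && (i != i1)) d i)%N.
      apply: leq_sum => i /andP[i0 ne];
        rewrite Ha /e /dd (negbTE i0) (negbTE ne) !neq_tagk //.
      by case: eqP; lia.
    move: le; set u := (\sum_(i | _) expo a i (emb i j'))%N;
      set v := (\sum_(i | _) d i)%N.
    rewrite !Ha /e /dd !eqxx (negbTE i10) !eq_tagk [tagk (emb ord0 j') ==
      _]neq_tagk 1?eq_sym //.
    rewrite [tagk (emb i1 j') == _]neq_tagk // /k1 !(inj_eq (emb_inj n_mono (i :=
      i1))) emb0 //.
    clearbody u v; have := d_gap i10; have := valP k; move: l0j => /=.
    rewrite mul0n !muln0 emb0 //.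
    case: (eqVneq j' j) => [->|_]; last by case: eqP => _; case: eqP => _; lia.
    by rewrite ![j == _]eq_sym => /negbTE -> /negbTE -> /=; lia.
  exists (enum_rank_in Aa a); rewrite /A enum_rankK_in //; split; last first.
    move=> l ll0; rewrite Ha /e eqxx mul0n add0n eq_tagk (negbTE ll0) muln0 neq_tagk //.
    by rewrite eq_sym.
  apply/andP; split.
    by rewrite Ha /e /dd (negbTE i10) eqxx (negbTE (k1j k)) muln0 neq_tagk // muln0
      eq_tagk eqxx.
  apply/forallP => -[i q]; apply/implyP => /= /and3P[i0 qj qk].
  by rewrite Ha /e (negbTE qj) muln0 neq_tagk // muln0 (negbTE qk).
have [s Hs] := fin_all_exists ex_s.
pose E i (l : K) := expo (alpha i) ord0 (val l).
have th := @forms_thin C N K K (d ord0) A E s (Sub l0 l0j) (leqnn _) _ _ _ _.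
apply: thinS (th _ _ _ _).
- move=> c [h [y [ch vh _ yl0 Hy]]]; exists (fun l => y ord0 0 (val l)); split=> // k.
  have yk : y i1 0 (k1 k) = 0 by have [_] := Hy i1 i10; apply.
  have := vanish_dir vh yk; rewrite (allowed_form_sum _ _ ch).
  pose cst := \prod_(i | i != ord0) y i 0 (emb i j) ^+ dd i.
  have cst0 : cst != 0.
    by apply/prodf_neq0 => i i0; rewrite expf_neq0 //; have [] := Hy i i0.
  rewrite (bigID (A k)) /= [X in _ + X]big1 ?addr0 => [|i /andP[/eqP e1]]; last first.
    rewrite /A e1 eqxx /= negb_forall => /existsP[q].
    rewrite negb_imply => /andP[/and3P[q0 qj qk] qe].
    rewrite (bigD1 q) //=; have [_ ->//] := Hy _ q0.
    by rewrite expr0n (negbTE qe) mul0r mulr0.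
  rewrite (eq_bigl (A k)) => [|i]; last by rewrite andb_idl // => /andP[].
  rewrite (eq_bigr (fun i => cst * (c i * \prod_l y ord0 0 (val l) ^+ E i l))).
    by rewrite -mulr_sumr => /eqP; rewrite mulf_eq0 (negbTE cst0) => /eqP.
  move=> i Aki; rewrite mulrCA; congr (_ * _).
  pose F i' (q : 'I_(n i').+1) := if tagk q == tagk (k1 k) then 1
    else y i' 0 q ^+ expo (alpha i) i' q.
  transitivity (\prod_i' \prod_(q < (n i').+1) F i' q).
    rewrite (sig_big_dep _ _ F) /= big_mkcond /=; apply: eq_bigr => -[i' q] _ /=.
    by rewrite /F; case: eqP.
  rewrite (bigD1 ord0) //= mulrC; congr (_ * _).
    apply: eq_bigr => i' i'0; rewrite (bigD1 (emb i' j)) //= big1 ?mulr1 => [|q qj].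
      rewrite /F (Aexp k) //; case: eqP => // e.
      have := congr1 (fun q : Q => tagged q == emb (tag q) j) e.
      by rewrite /= eqxx (negbTE (k1j k)).
    rewrite /F; case: ifP => // qk; move: Aki => /andP[_ /forallP/(_ (tagk q))].
    by rewrite /= i'0 qj qk => /eqP ->.
  rewrite (bigD1 j) //= {1}/F (A0 k) // expr0 if_same mul1r.
  rewrite (reindex_omap (val : K -> _) insub) /= => [|l lj]; last by rewrite insubT.
  apply: eq_big => [l|l _]; first by rewrite valK (valP l) eqxx.
  by rewrite /F neq_tagk // eq_sym.
- move=> k k' i /andP[/eqP e1 _] /andP[_ /forallP/(_ (tagk (k1 k)))].
  rewrite /= i10 k1j eq_tagk e1 implybF negbK => /eqP/(emb_inj n_mono (i := i1)).
  exact: val_inj.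
- move=> k i Aki; rewrite -(expo_sum (alpha i) ord0) [RHS](bigD1 j) //= (A0 k) // add0n.
  rewrite [RHS](reindex_omap (val : K -> _) insub) /= => [|l lj];
    last by rewrite insubT.
  by apply: eq_big => [l|l _]; rewrite ?valK ?(valP l) ?eqxx.
- by move=> k; have [] := Hs k.
- by move=> k l ll0; have [_] := Hs k; apply.
Qed.

Lemma generic_sing (i1 : 'I_r.+1) : i1 != ord0 ->
  thin (fun c : 'I_N -> C => exists h (y : pt),
    [/\ allowed_form c h, vanish 2 h y, forall i, y i != 0
      & ~ exists j, forall i (k : 'I_(n i).+1), k != emb i j -> y i 0 k = 0]).
Proof.
move=> i10.
pose B (p : {set Q} + 'I_(n ord0).+1 * 'I_(n ord0).+1) (c : 'I_N -> C) :=
  match p with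
  | inl T => exists h (y : pt),
    [/\ allowed_form c h, vanish 2 h y,
        forall q : Q, (y (tag q) 0 (tagged q) != 0) = (q \in T)
      & exists2 a : 'I_svs, allowed a &
          forall q : Q, q \notin T -> expo a (tag q) (tagged q) = 0%N]
  | inr (j, l0) => exists h (y : pt),
    [/\ allowed_form c h, vanish 2 h y, l0 != j, y ord0 0 l0 != 0
      & forall i, i != ord0 -> y i 0 (emb i j) != 0 /\
          forall k : 'I_(n i).+1, k != emb i j -> y i 0 k = 0]
  end.
apply: (thinS _ (thin_union (B := B) _)); last first.
  by case=> [S|[j l0]]; [apply: toric_sing_thin | apply: base_sing_thin i10].
move=> c [h [y [ch vh y0 ny]]].
have [/existsP[j /forallP Hj]|] := boolP [exists j, [forall q : Q,
    (tag q != ord0) && (tagged q != emb (tag q) j) ==> (y (tag q) 0 (tagged q) == 0)]].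
  have base i (k : 'I_(n i).+1) : i != ord0 -> k != emb i j -> y i 0 k = 0.
    by move=> i0 kj; have := Hj (tagk k); rewrite /= i0 kj => /eqP.
  have [l0 /andP[l0j yl0]|noL] := pickP [pred l | (l != j) && (y ord0 0 l != 0)].
    exists (inr (j, l0)); exists h, y; split=> // i i0; split; last by move=> k;
      apply: base.
    have /rV0Pn[k yk] := y0 i; apply: contra yk => /eqP e.
    by have [->|kj] := eqVneq k (emb i j); [rewrite e | rewrite base].
  case: ny; exists j => i; case: (eqVneq i ord0) => [->|i0] k;
    last exact: (base _ _ i0).
  rewrite emb0 // => kj; have := noL k; rewrite /= kj /=.
  by move=> /negbT; rewrite negbK => /eqP.
rewrite negb_exists => /forallP Hj.
exists (inl [set q : Q | y (tag q) 0 (tagged q) != 0]); exists h, y; split=> //.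
  by move=> q; rewrite inE.
have [i|j|a Aa Sa] := @allowed_ex r n d n_mono d_gap (fun i k => y i 0 k != 0).
- exact/rV0Pn/y0.
- have := Hj j; rewrite negb_forall => /existsP[[i k]] /=.
  by rewrite negb_imply => /andP[/andP[i0 kj] yk]; exists i, k.
by exists a => // q; rewrite inE => nq; apply: Sa.
Qed.

End Generic.

(** * Zariski closed sets *)

Section Multihomog.

Variables (C : fieldType) (k m : nat).
Implicit Types (f g : {mpoly C[k * m]}) (e : 'I_k -> nat).

Lemma eq_multihomog e e' f : e =1 e' -> multihomog e f -> multihomog e' f.
Proof. by move=> ee' fe u uf j; rewrite fe. Qed.

Lemma multihomogC c : multihomog (fun=> 0%N) (c%:MP : {mpoly C[k * m]}).
Proof.
move=> u; rewrite msuppC; case: eqP => // _; rewrite inE => /eqP -> j.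
by rewrite big1 // => i _; rewrite mnm0E.
Qed.

Lemma multihomogX j0 a :
  multihomog (fun j => j == j0 : nat) ('X_(mxvec_index j0 a) : {mpoly C[k * m]}).
Proof.
move=> u; rewrite msuppX inE => /eqP -> j.
under eq_bigr => i _ do rewrite mnm1E (inj_eq (@cast_ord_inj _ _ _))
  (inj_eq enum_rank_inj) xpair_eqE eq_sym.
case: eqVneq => _; last by rewrite big1.
by rewrite (bigD1 a) //= eqxx big1 // => i /negbTE; rewrite eq_sym => ->.
Qed.

Lemma multihomogD e f g : multihomog e f -> multihomog e g -> multihomog e (f + g).
Proof.
by move=> fe ge u /msuppD_le; rewrite mem_cat => /orP[/fe|/ge].
Qed.

Lemma multihomogZ e c f : multihomog e f -> multihomog e (c *: f).
Proof. by move=> fe u /msuppZ_le/fe. Qed.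

Lemma multihomogM e e' f g : multihomog e f -> multihomog e' g ->
  multihomog (fun j => e j + e' j)%N (f * g).
Proof.
move=> fe ge u /msuppM_le/allpairsP[[u1 u2] /= [uf ug ->]] j.
rewrite -(fe _ uf) -(ge _ ug) -big_split; apply: eq_bigr => i _.
by rewrite mnmDE.
Qed.

Lemma multihomog_sum (I : Type) (s : seq I) (P : pred I) e (f : I -> {mpoly C[k * m]}) :
  (forall i, multihomog e (f i)) -> multihomog e (\sum_(i <- s | P i) f i).
Proof.
move=> fe; apply: big_ind => [u|p q|i _];
  [by rewrite msupp0 | exact: multihomogD | exact: fe].
Qed.

Lemma multihomog_prod (I : Type) (s : seq I) (e : I -> 'I_k -> nat) (f : I ->
  {mpoly C[k * m]}) :
  (forall i, multihomog (e i) (f i)) ->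
  multihomog (fun j => \sum_(i <- s) e i j)%N (\prod_(i <- s) f i).
Proof.
move=> fe; elim: s => [|i s IH].
  rewrite big_nil -mpolyC1; apply: (eq_multihomog _ (@multihomogC 1)) => j.
  by rewrite big_nil.
rewrite big_cons; apply: (eq_multihomog _ (multihomogM (fe i) IH)) => j.
by rewrite big_cons.
Qed.

Lemma mx_evalX (p : 'M[C]_(k, m)) j a : mx_eval 'X_(mxvec_index j a) p = p j a.
Proof. by rewrite /mx_eval mevalXU mxvecE. Qed.

Lemma zariski_closedU (A B : 'M[C]_(k, m) -> Prop) :
  zariski_closed A -> zariski_closed B -> zariski_closed (fun p => A p \/ B p).
Proof.
move=> [SA [SAh SAE]] [SB [SBh SBE]].
exists (fun h => exists f g, [/\ SA f, SB g & h = f * g]); split.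
  move=> _ [f [g [/SAh[e fe] /SBh[e' ge] ->]]].
  by exists (fun j => e j + e' j)%N; apply: multihomogM.
move=> p; split.
  case=> [/SAE|/SBE] [p0 Hp]; split=> // _ [f [g [Sf Sg ->]]].
    by rewrite /mx_eval mevalM -/(mx_eval f p) Hp // mul0r.
  by rewrite /mx_eval mevalM -/(mx_eval g p) Hp // mulr0.
move=> [p0 Hp]; have [Ap|nAp] := pselect (A p); [by left | right].
apply/SBE; split=> // g Sg; apply: contrapT => /eqP gp.
apply: nAp; apply/SAE; split=> // f Sf.
have /eqP : mx_eval (f * g) p = 0 by apply: Hp; exists f, g.
by rewrite /mx_eval mevalM mulf_eq0 (negbTE gp) orbF => /eqP.
Qed.

Lemma zariski_closed0 : zariski_closed (fun p : 'M[C]_(k, m) => False).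
Proof.
exists (fun f => f = 1%:MP); split=> [f ->|p]; first by exists (fun=> 0%N);
  apply: multihomogC.
split=> // -[_ /(_ _ erefl)]; rewrite /mx_eval mevalC => /eqP.
by rewrite oner_eq0.
Qed.

Lemma zariski_closed_ex (J : eqType) (s : seq J) (A : J -> 'M[C]_(k, m) -> Prop) :
  (forall j, zariski_closed (A j)) ->
  zariski_closed (fun p => exists2 j, j \in s & A j p).
Proof.
move=> clA; elim: s => [|j s IH].
  have [S [hS SE]] := zariski_closed0; exists S; split=> // p.
  by rewrite -SE; split=> // -[].
have [S [hS SE]] := zariski_closedU (clA j) IH; exists S; split=> // p.
rewrite -SE; split=> [[l]|[Aj|[l ls Al]]].
- by rewrite inE => /orP[/eqP ->|ls Al]; [left | right; exists l].
- by exists j; rewrite ?mem_head.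
- by exists l; rewrite // inE ls orbT.
Qed.

Lemma irreducible_closed_ex (W : 'M[C]_(k, m) -> Prop) (J : eqType) (s : seq J)
    (A : J -> 'M[C]_(k, m) -> Prop) :
    irreducible_closed W -> (forall j, zariski_closed (A j)) ->
    (forall p, W p -> exists2 j, j \in s & A j p) ->
  exists j, forall p, W p -> A j p.
Proof.
move=> [_ [p Wp] irr] clA; elim: s => [|j s IH] WA; first by have [] := WA p Wp.
have [|WAj|Ws] := irr _ _ (clA j) (zariski_closed_ex s clA).
- move=> q /WA[l]; rewrite inE => /orP[/eqP ->|ls Al]; first by left.
  by right; exists l.
- by exists j.
- exact: IH.
Qed.

End Multihomog.

Section Points.

Variables (C : numFieldType) (m : nat).
Implicit Types (p q : 'rV[C]_m).

Lemma mdeg_row (u : 'X_{1..1 * m}) : mdeg u = (\sum_(i < m) u (mxvec_index ord0 i))%N.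
Proof.
rewrite mdegE (reindex _ (curry_mxvec_bij 1 m)) /=.
transitivity (\sum_(p : 'I_1 * 'I_m) u (mxvec_index p.1 p.2))%N.
  by apply: eq_bigr => -[].
by rewrite -(pair_bigA _ (fun i j => u (mxvec_index i j))) /= big_ord1.
Qed.

Lemma dhomog_multihomog e (f : {mpoly C[1 * m]}) :
  f \is e.-homog -> multihomog (fun=> e) f.
Proof.
by move=> fe u uf j; rewrite ord1 -mdeg_row (dhomog_mf fe uf).
Qed.

Lemma dhomog_eval_scale e (f : {mpoly C[1 * m]}) c p :
  f \is e.-homog -> mx_eval f (c *: p) = c ^+ e * mx_eval f p.
Proof.
move=> fe; rewrite /mx_eval !mevalE mulr_sumr !big_seq; apply: eq_bigr => u uf.
rewrite mulrCA -(dhomog_mf fe uf) /= mdegE -prodrXr -big_split /=; congr (_ * _).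
by apply: eq_bigr => a _; rewrite linearZ mxE exprMn.
Qed.

Lemma closed_scale (Z : 'rV[C]_m -> Prop) c p :
  zariski_closed Z -> c != 0 -> Z p -> Z (c *: p).
Proof.
move=> [S [Sh SE]] c0 /SE[p0 Hp]; apply/SE; split=> [j|f Sf].
  by rewrite linearZ /= scaler_eq0 (negbTE c0) p0.
have [e fe] := Sh _ Sf; rewrite (@dhomog_eval_scale (e 0)); first by rewrite Hp ?mulr0.
by apply/dhomogP => u uf; rewrite -(fe u uf 0) -mdeg_row.
Qed.

(** Proportionality to p is the vanishing of the 2 x 2 minors. *)
Lemma zariski_closed_pt p : p != 0 ->
  zariski_closed (fun q => exists2 c, c != 0 & q = c *: p).
Proof.
move=> p0; exists (fun f => exists a b : 'I_m, f = p 0 b *: 'X_(mxvec_index ord0 a) -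
  p 0 a *: 'X_(mxvec_index ord0 b)); split.
  move=> _ [a [b ->]]; exists (fun j => j == ord0 : nat); rewrite -scaleNr.
  by apply: multihomogD; apply: multihomogZ; apply: multihomogX.
have ev q a b : mx_eval (p 0 b *: 'X_(mxvec_index ord0 a) -
    p 0 a *: 'X_(mxvec_index ord0 b)) q = p 0 b * q 0 a - p 0 a * q 0 b.
  by rewrite /mx_eval mevalB !mevalZ -!/(mx_eval _ _) !mx_evalX.
move=> q; split=> [[c c0 ->]|[q0 Hq]].
  split=> [j|_ [a [b ->]]]; first by rewrite row_id scaler_eq0 negb_or c0.
  by rewrite ev !mxE; ring.
have [b pb] := rV0Pn _ p0.
have qE : q = (q 0 b / p 0 b) *: p.
  apply/rowP => a; rewrite mxE; apply: (mulfI pb).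
  have /eqP : p 0 b * q 0 a - p 0 a * q 0 b = 0 by rewrite -ev; apply: Hq; exists a, b.
  by rewrite subr_eq0 => /eqP ->; field.
exists (q 0 b / p 0 b) => //; apply: contraNneq (q0 0) => c0.
by rewrite row_id qE c0 scale0r.
Qed.

Lemma dim_ge1_not_finite (Y : 'rV[C]_m -> Prop) (J : finType) (p : J -> 'rV[C]_m) :
    (forall j, p j != 0) -> dim_ge Y 1 ->
  exists x, Y x /\ forall j c, c != 0 -> x <> c *: p j.
Proof.
move=> p0 [W [HW chain]]; apply: contrapT => /forallNP nY.
have [[irr0 _] [irr1 W1Y]] := (HW ord0, HW (lift ord0 ord0)).
have [W01 [x [W1x nW0x]]] := chain ord0 (lift ord0 ord0) isT.
have [|j Hj] := irreducible_closed_ex (s := enum J) irr1 (fun j =>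
  zariski_closed_pt (p0 j)).
  move=> q /W1Y Yq; have := nY q; rewrite not_andP => -[//|].
  move/existsNP => [j /existsNP[c]]; rewrite not_implyE => -[c0 /contrapT qc].
  by exists j; [rewrite mem_enum | exists c].
have [cl0 [q W0q] _] := irr0.
have [c c0 xc] := Hj _ W1x; have [c' c'0 qc] := Hj _ (W01 _ W0q).
apply: nW0x; have -> : x = (c / c') *: q by rewrite qc scalerA divfK.
by apply: closed_scale => //; rewrite mulf_neq0 ?invr_eq0.
Qed.

(* A homogeneous component does the job: on a cone, all components of a
   vanishing polynomial vanish. *)
Lemma cone_homog (B : 'rV[C]_m -> Prop) (f : {mpoly C[1 * m]}) h :
    (forall c b, c != 0 -> B b -> B (c *: b)) ->
    (forall b, B b -> mx_eval f b = 0) -> mx_eval f h != 0 ->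
  exists g, [/\ exists e, multihomog e g, forall b, B b -> mx_eval g b = 0
              & mx_eval g h != 0].
Proof.
move=> cone fB fh.
have fE : f = \sum_(e < msize f) pihomog mdeg e f by apply: pihomog_partitionE.
have [e eh] : exists e : 'I_(msize f), mx_eval (pihomog mdeg e f) h != 0.
  apply/existsP; apply: contraNT fh; rewrite negb_exists => /forallP h0.
  rewrite fE /mx_eval raddf_sum big1 // => e _.
  by apply/eqP; rewrite -[_ == 0]negbK; apply: h0.
exists (pihomog mdeg e f); split=> // [|b Bb].
  by exists (fun=> e : nat); apply/dhomog_multihomog/pihomogP.
(* The extra factor X covers s = 0, about which the cone condition says nothing; it also shifts the
   coefficient read off below by one. *)
pose P : {poly C} := 'X * \poly_(i < msize f) mx_eval (pihomog mdeg i f) b.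
have P0 : P = 0.
  apply: poly_fun0 => s; rewrite hornerM hornerX.
  have [->|s0] := eqVneq s 0; first by rewrite mul0r.
  rewrite -[RHS](mulr0 s) -[X in _ = _ * X](fB _ (cone _ _ s0 Bb)) [in RHS]fE.
  congr (_ * _); rewrite horner_poly [in RHS]/mx_eval raddf_sum;
    apply: eq_bigr => i _ /=.
  by rewrite -/(mx_eval _ _) (dhomog_eval_scale _ _ (pihomogP _ _ _)) mulrC.
have := congr1 (fun q : {poly C} => q`_e.+1) P0.
by rewrite coefXM /= coef_poly ltn_ord coef0.
Qed.

End Points.

(** * General hyperplanes *)

Section Main.

Variables (r : nat) (n d : 'I_r.+1 -> nat) (C : numClosedFieldType).
Notation svs := (sv_size n d).
Notation pt := (forall i, 'rV[C]_(n i).+1).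
Hypothesis d_gt0 : forall i, (0 < d i)%N.
Hypothesis n_mono : forall i, (n ord0 <= n i)%N.
Hypothesis d_gap : forall i, i != ord0 -> (d ord0 + 2 <= d i)%N.

Local Notation emb := (@emb r n).
Local Notation N := #|@allowed r n d|.
Local Notation alpha := (@enum_val _ (@allowed r n d)).
Local Notation cpt j := (coord_pt C (fun i => emb i j)).

Lemma sv_form_act g (G : 'M[C]_svs) h x :
  (forall x, sv_map d (act g x) = sv_map d x *m G) ->
  sv_form (h *m G^T) x = sv_form h (act g x).
Proof. by move=> gG; rewrite !sv_formE -mulmxA -trmx_mul gG. Qed.

Lemma lin_spanS m (S : 'rV[C]_m -> Prop) w : S w -> lin_span S w.
Proof. by move=> Sw U; apply. Qed.

Lemma sv_map_neq0 (x : pt) (piv : forall i, 'I_(n i).+1) :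
  (forall i, x i 0 (piv i) = 1) -> sv_map d x != 0.
Proof.
move=> x1; apply/rV0Pn; have [a Ha] := expo_neighbour d_gt0 piv (piv ord0); exists a.
rewrite sv_mapE (mon_neighbour _ Ha) /coords x1 mulr1.
by apply/prodf_neq0 => i _; rewrite x1 expr1n oner_eq0.
Qed.

Section Inner.

Variables (p : 'I_(n ord0).+1 -> 'rV[C]_svs) (X : 'I_(n ord0).+1 -> pt).
Variables (piv : 'I_(n ord0).+1 -> forall i, 'I_(n i).+1) (c : 'I_(n ord0).+1 -> C).
Variables g g' : forall i, 'M[C]_((n i).+1).
Hypothesis X_piv : forall j i, X j i 0 (piv j i) = 1.
Hypothesis c_neq0 : forall j, c j != 0.
Hypothesis pE : forall j, p j = c j *: sv_map d (X j).
Hypothesis gX : forall j, act g (cpt j) = X j.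
Hypothesis gK : forall x, act g' (act g x) = x.
Hypothesis g'K : forall x, act g (act g' x) = x.

Let T := lin_span (fun w => exists j, osc_space (SV n d) (sv_dim n) (d ord0) (p j) w).

Lemma inner_general :
  for_general (hyperplanes_through T)
    (fun h => ~ tangent_along_pos_dim h (SV n d) (sv_dim n)).
Proof.
have [G gG] := sv_map_act d g; have [G' gG'] := sv_map_act d g'.
(* A hyperplane is determined by its form, so G and G' are inverse to each other because g and g'
   are. *)
have G'G (h : 'rV[C]_svs) : h *m G'^T *m G^T = h.
  apply/eqP; rewrite -subr_eq0; apply/eqP; apply: sv_form_eq0 => x.
  have -> : sv_form (h *m G'^T *m G^T - h) x = sv_form (h *m G'^T *m G^T) x -
    sv_form h x.
    by rewrite !sv_formE mulmxBl mxE [X in _ + X]mxE.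
  by rewrite (sv_form_act _ _ gG) (sv_form_act _ _ gG') gK subrr.
have G_inj (h : 'rV[C]_svs) : h *m G^T = 0 -> h = 0.
  move=> h0; apply: sv_form_eq0 => x; rewrite -(g'K x) -(sv_form_act _ _ gG) h0.
  by rewrite sv_formE mul0mx mxE.
(* With [L_of], this identifies the hyperplanes through T with the nonzero forms on allowed
   monomials. *)
have L_allowed (h : 'rV[C]_svs) a : hyperplanes_through T h -> ~~ allowed a -> (h
  *m G^T) 0 a = 0.
  move=> [_ hT]; rewrite negb_forall => /existsP[j]; rewrite -leqNgt => le.
  apply: (@vanish_coord_pt _ _ _ _ (fun i => emb i j) (d ord0).+1); last exact: le.
  apply: vanish_act gG _; rewrite gX.
  apply: (osc_vanish d_gt0 (X_piv j) (c_neq0 j)); rewrite -pE => w hw.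
  by apply: hT; apply: lin_spanS; exists j.
have L_of (h : 'rV[C]_svs) : (forall a, ~~ allowed a -> h 0 a = 0) -> h != 0 ->
    hyperplanes_through T (h *m G'^T).
  move=> h0 hn0; split.
    by apply: contra_neq hn0 => e; rewrite -(G'G h) e mul0mx.
  apply: lin_span_hyperplane => w [j]; rewrite pE.
  apply: (osc_order (g := g') d_gt0 (c_neq0 j) gG'); first by rewrite -gX gK.
  move=> a ha; have /forallP/(_ j) : allowed a; last by [].
  by apply: contraNT ha => /h0 ->.
pose bad (h : 'rV[C]_svs) := exists c (y : pt), [/\ allowed_form c (h *m G^T),
  vanish 2 (h *m G^T) y,
  forall i, y i != 0 & ~ exists j, forall i (k : 'I_(n i).+1), k != emb i j -> y i
    0 k = 0].
(* The Zariski closure of the cone [bad]. *)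
exists (fun h => h != 0 /\ forall f, (exists e, multihomog e f) ->
  (forall b, bad b -> mx_eval f b = 0) -> mx_eval f h = 0).
split; last split.
- exists (fun f => (exists e, multihomog e f) /\ forall b, bad b -> mx_eval f b = 0).
  split=> [f []|h] //; split=> [[h0 Hh]|[h0 Hh]]; split.
  + by move=> j; rewrite ord1 row_id.
  + by move=> f [fe fb]; apply: Hh.
  + by rewrite -(row_id 0 h) h0.
  + by move=> f fe fb; apply: Hh.
- move=> [h1 Lh1].
  (* With a single factor, being allowed would read expo + d_1 < d_1; then h1 would be zero. *)
  have [i1 i10|no_i1] := pickP (fun i : 'I_r.+1 => i != ord0); last first.
    case: (Lh1) => /negP[]; apply/eqP/G_inj/rowP => a; rewrite [RHS]mxE L_allowed //.
    apply/negP => /allowedP/(_ ord0);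
      rewrite (bigD1 ord0) //= [X in (_ < X)%N](bigD1 ord0) //=.
    by rewrite !big_pred0 //; lia.
  have N0 : (0 < N)%N.
    rewrite lt0n; apply/negP => /eqP/card0_eq N0.
    case: (Lh1) => /negP[]; apply/eqP/G_inj/rowP => a; rewrite [RHS]mxE L_allowed //.
    by apply/negP => Aa; move: (N0 a); rewrite [a \in _]Aa.
  have [D D0 HD] := @generic_sing r n d C d_gt0 n_mono d_gap i1 i10.
  (* The additional variable forces a coefficient of the chosen form to be nonzero, so that it does
     define a hyperplane. *)
  pose D' := D * 'X_(Ordinal N0).
  have D'0 : D' != 0.
    rewrite mulf_neq0 //; apply/eqP => /(congr1 (meval (fun=> 1))).
    by rewrite mevalXU meval0 => /eqP; rewrite oner_eq0.
  have [cc Dcc] : exists cc, D'.@[cc] != 0.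
    apply: contrapT => /forallNP H; move/negP: D'0; apply; apply/eqP/mpoly_fun0 => x.
    by apply/eqP/negPn/negP/H.
  pose h' : 'rV[C]_svs := \row_a
    (if [pick i | alpha i == a] is Some i then cc i else 0).
  have h'E i : h' 0 (alpha i) = cc i.
    rewrite mxE; case: pickP => [i' /eqP/enum_val_inj -> //|/(_ i)].
    by rewrite eqxx.
  have h'0 a : ~~ allowed a -> h' 0 a = 0.
    rewrite mxE; case: pickP => // i /eqP <- /negP[]; exact: (enum_valP i).
  have h'n0 : h' != 0.
    apply: contraNneq Dcc => e; rewrite mevalM mevalXU -h'E e mxE.
    by rewrite mulr0.
  exists (h' *m G'^T); split; first exact: L_of.
  (* D as a function of the untransformed h; it need not be homogeneous, which [cone_homog]
     repairs. *)
  pose f0 : {mpoly C[1 * svs]} := D \mPo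
    [tuple \sum_a G (alpha i) a *: 'X_(mxvec_index ord0 a) | i < N].
  have f0E (h : 'rV[C]_svs) : mx_eval f0 h = D.@[fun i => (h *m G^T) 0 (alpha i)].
    rewrite /mx_eval comp_mpoly_meval; apply: meval_eq => i.
    rewrite tnth_mktuple raddf_sum mxE; apply: eq_bigr => a _ /=.
    by rewrite mevalZ -/(mx_eval _ _) mx_evalX mxE mulrC.
  have bad_cone s b : s != 0 -> bad b -> bad (s *: b).
    move=> s0 [cb [y [[b0 bE] vb y0 ny]]]; exists (fun i => s * cb i), y.
    split=> //; rewrite -scalemxAl.
      by split=> [a na|i]; [rewrite mxE b0 // mulr0 | rewrite bE [RHS]mxE].
    move=> w; have -> : line_form (s *: (b *m G^T)) y w = s *: line_form (b *m G^T) y w.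
      rewrite /line_form scaler_sumr; apply: eq_bigr => a _.
      by rewrite mxE polyCM -mulrA mul_polyC.
    by rewrite dvdpZr.
  have f0bad b : bad b -> mx_eval f0 b = 0.
    move=> [cb [y [cbE vb y0 ny]]]; rewrite f0E -[RHS](HD cb).
      by apply: meval_eq => i; rewrite cbE.2.
    by exists (b *m G^T), y.
  have f0h : mx_eval f0 (h' *m G'^T) != 0.
    rewrite f0E G'G; apply: contra Dcc => /eqP D0'; rewrite mevalM.
    suff -> : D.@[cc] = 0 by rewrite mul0r.
    by rewrite -[RHS]D0'; apply: meval_eq => i; rewrite h'E.
  have [f [fe fb fh]] := cone_homog bad_cone f0bad f0h.
  by move=> [_ /(_ f fe fb) fh0]; rewrite fh0 eqxx in fh.
move=> h Lh nZ [Y [Yirr YX Ydim Ytan]].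
have nbad : ~ bad h.
  move=> bh; apply: nZ; split; first by case: Lh.
  by move=> f _; apply.
have p0 j : p j != 0.
  by rewrite pE scaler_eq0 negb_or c_neq0 (sv_map_neq0 (X_piv j)).
(* A positive dimensional Y has a point other than all the p_j; h is singular there, and its
   preimage under g is shown not to be a coordinate point. *)
have [x' [Yx' x'p]] := dim_ge1_not_finite p0 Ydim.
have [x [pv [x1 [c1 c10 x'E]]]] := SV_normal (YX _ Yx').
have vx : vanish 2 h x.
  apply: (osc_vanish d_gt0 x1 c10); rewrite -x'E; exact: Ytan.
have vy : vanish 2 (h *m G^T) (act g' x) by apply: vanish_act gG _; rewrite g'K.
apply: nbad; exists (fun i => (h *m G^T) 0 (alpha i)), (act g' x); split=> //.
- by split=> // a na; apply: L_allowed.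
- move=> i; apply: contra_eqN (x1 i) => /eqP y0.
  have -> : x i = act g (act g' x) i by rewrite g'K.
  by rewrite /act -/(act g' x i) y0 mul0mx mxE eq_sym oner_eq0.
move=> [j Hj].
(* If the preimage were e_j, then x would be proportional to X j in every factor, hence x' to p
   j. *)
pose l i := act g' x i 0 (emb i j).
have yE i : act g' x i = l i *: cpt j i.
  apply/rowP => k; rewrite [RHS]mxE [cpt j i 0 k]mxE eqxx /=.
  have [->|kj] := eqVneq k (emb i j); first by rewrite mulr1.
  by rewrite mulr0; apply: Hj.
have xE i : x i = l i *: X j i.
  by rewrite -gX -{1}(g'K x) {1}/act yE -scalemxAl.
have l0 i : l i != 0.
  by apply: contra_eqN (x1 i) => /eqP e; rewrite xE e scale0r mxE eq_sym oner_eq0.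
apply: (x'p j (c1 * \prod_i l i ^+ d i / c j)).
  by rewrite !mulf_neq0 ?invr_eq0 //; apply/prodf_neq0 => i _; rewrite expf_neq0.
rewrite x'E pE scalerA divfK // -scalerA; congr (_ *: _).
apply/rowP => a; rewrite [RHS]mxE !sv_mapE -mon_scale; apply: eq_mon => i k.
by rewrite /coords xE mxE.
Qed.

End Inner.

End Main.

(** * Moving general points to coordinate points *)

Section Main.

Variables (r : nat) (n d : 'I_r.+1 -> nat) (C : numClosedFieldType).
Notation svs := (sv_size n d).
Notation pt := (forall i, 'rV[C]_(n i).+1).
Hypothesis d_gt0 : forall i, (0 < d i)%N.
Hypothesis n_mono : forall i, (n ord0 <= n i)%N.
Hypothesis d_gap : forall i, i != ord0 -> (d ord0 + 2 <= d i)%N.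

Local Notation emb := (@emb r n).
Local Notation cpt j := (coord_pt C (fun i => emb i j)).

(** The identity matrix with the rows in the image of [emb] replaced by the Y j. Up to reordering it
    is block triangular, with the given invertible block and an identity block on the diagonal. *)
Lemma complete_basis i (Y : 'I_(n ord0).+1 -> 'rV[C]_(n i).+1) :
  \det (\matrix_(j, l) Y j 0 (emb i l)) != 0 ->
  exists2 g : 'M[C]_((n i).+1), g \in unitmx & forall j, row (emb i j) g = Y j.
Proof.
move=> detY; have einj := emb_inj n_mono (i := i).
pose g := \matrix_(a, b) if [pick j | emb i j == a] is Some j then Y j 0 b else (a
  == b)%:R.
have gE j b : g (emb i j) b = Y j 0 b.
  rewrite mxE; case: pickP => [l /eqP/einj -> //|/(_ j)]; by rewrite eqxx.
exists g; last by move=> j; apply/rowP => b; rewrite mxE gE.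
rewrite -row_free_unit; apply: inj_row_free => v vg.
pose im a := [exists j, emb i j == a].
have nimE a b : ~~ im a -> g a b = (a == b)%:R.
  rewrite negb_exists mxE => /forallP na; case: pickP => // j ja.
  by have := na j; rewrite ja.
have vE b : \sum_(a | im a) v 0 a * g a b + \sum_(a | ~~ im a) v 0 a * (a == b)%:R = 0.
  have /rowP/(_ b) := vg; rewrite !mxE (bigID im) /= => vb; rewrite -[RHS]vb.
  by congr (_ + _); apply: eq_bigr => a na; rewrite nimE.
have v_emb : \row_j v 0 (emb i j) = 0 :> 'rV[C]_(n ord0).+1.
  have Yu : \matrix_(j, l) Y j 0 (emb i l) \in unitmx by rewrite unitmxE unitfE.
  apply: (can_inj (mulmxK Yu)); rewrite mul0mx; apply/rowP => l; have := vE (emb i l).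
  rewrite [X in _ + X]big1 ?addr0 => [vl|a na]; last first.
    have [e|_] := eqVneq a (emb i l); last by rewrite mulr0.
    by case/negP: na; rewrite e; apply/existsP; exists l.
  rewrite [RHS]mxE -[RHS]vl [LHS]mxE.
  rewrite (reindex_onto (emb i) (fun a => odflt ord0 [pick j | emb i j == a])) /=.
    apply: eq_big => [j|j _]; last by rewrite !mxE -gE mxE.
    apply/esym/andP; split; first by apply/existsP; exists j.
    by case: pickP => [l' /eqP/einj -> //|/(_ j)]; rewrite eqxx.
  move=> a /existsP[j ja]; case: pickP => [l' /eqP //|/(_ j)]; by rewrite ja.
apply/rowP => b; rewrite [RHS]mxE; have [/existsP[j /eqP <-]|nb] := boolP (im b).
  by have /rowP/(_ j) := v_emb; rewrite !mxE.
have := vE b; rewrite big1 ?add0r => [|a /existsP[j /eqP <-]]; last first.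
  by have /rowP/(_ j) := v_emb; rewrite !mxE => ->; rewrite mul0r.
rewrite (bigD1 b) //= eqxx mulr1 big1 ?addr0 // => a /andP[_ /negbTE ->].
by rewrite mulr0.
Qed.

Lemma frame (X : 'I_(n ord0).+1 -> pt) :
    (forall i, \det (\matrix_(j, l) X j i 0 (emb i l)) != 0) ->
  exists g g' : forall i, 'M[C]_((n i).+1), [/\ forall j, act g (cpt j) = X j,
    forall x, act g' (act g x) = x & forall x, act g (act g' x) = x].
Proof.
move=> detX; have ex i : exists g : 'M[C]_((n i).+1),
    g \in unitmx /\ forall j, row (emb i j) g = X j i.
  by have [g gu gE] := complete_basis (detX i); exists g.
have [g Hg] := fin_all_exists ex; exists g, (fun i => invmx (g i)).
split=> [j|x|x]; apply: functional_extensionality_dep => i; have [gu gE] := Hg i.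
- by rewrite /act -rowE gE.
- by rewrite /act mulmxK.
- by rewrite /act mulmxKV.
Qed.

(** The open condition on the points is that, in each factor, their first n_1 + 1 coordinates form
    an invertible matrix. It must be a multihomogeneous condition on the ambient coordinates, so
    x^i_l is read off the monomial [ix i l], the neighbour of the pure power of the 0-th
    coordinates, up to a factor common to all l. *)
Theorem general_hyperplane :
  for_general (fun p : 'M[C]_((n ord0).+1, svs) => forall j, SV n d (row j p))
    (fun p => for_general
      (hyperplanes_through (lin_span (fun w =>
         exists j, osc_space (SV n d) (sv_dim n) (d ord0) (row j p) w)))
      (fun h => ~ tangent_along_pos_dim h (SV n d) (sv_dim n))).
Proof.
have [nb Hnb] := fin_all_exists (fun q : {i : 'I_r.+1 & 'I_(n i).+1} =>
  expo_neighbour d_gt0 (fun i => ord0) (tagged q)).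
pose ix i l := nb (Tagged (fun i => 'I_(n i).+1) (emb i l)).
pose M i : 'M[{mpoly C[(n ord0).+1 * svs]}]_((n ord0).+1) :=
  \matrix_(j, l) 'X_(mxvec_index j (ix i l)).
pose F := \prod_i \det (M i).
have FE p : mx_eval F p = \prod_i \det (\matrix_(j, l) p j (ix i l)).
  rewrite /mx_eval rmorph_prod; apply: eq_bigr => i _ /=.
  rewrite -(det_map_mx (meval _)); congr (\det _); apply/matrixP => j l.
  by rewrite !mxE; apply: mx_evalX.
have Fh : multihomog (fun j => \sum_(i < r.+1) 1)%N F.
  apply: multihomog_prod => i; apply: multihomog_sum => s.
  rewrite -[(-1) ^+ _](rmorph_sign (@mpolyC _ _)) mul_mpolyC; apply: multihomogZ.
  apply: (@eq_multihomog _ _ _ (fun j => \sum_j' (j == j'))%N) => [j|].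
    by rewrite (bigD1 j) //= eqxx big1 // => j' /negbTE; rewrite eq_sym => ->.
  by apply: multihomog_prod => j; rewrite mxE; apply: multihomogX.
exists (fun p => (forall j, row j p != 0) /\ mx_eval F p = 0); split; last split.
- exists (fun f => f = F); split=> [f ->|p];
  first by exists (fun j => \sum_(i < r.+1) 1)%N.
  by split=> -[p0 Fp]; split=> //; [move=> f -> | apply: Fp].
(* In each factor the j-th point is the sum of the 0-th and j-th unit vectors (the 0-th one alone
   for j = 0), so every matrix is triangular with unit diagonal. *)
- move=> _; pose X j : pt := fun i => \row_k ((k == ord0)%:R + ((j != ord0) && (k
  == emb i j))%:R).
  have X0 j i : X j i 0 ord0 = 1.
    rewrite mxE eqxx; case: (eqVneq j ord0) => j0; rewrite ?addr0 //=.
    rewrite -val_eqE /= val_emb // eq_sym (_ : (j == 0 :> nat) = false) ?addr0 //.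
    exact: negbTE.
  exists (\matrix_j sv_map d (X j)); split=> [j|[_]].
    rewrite rowK; exists (X j); split=> [i|].
      by apply/rV0Pn; exists ord0; rewrite X0 oner_eq0.
    by exists 1; rewrite oner_eq0 scale1r.
  apply/eqP; rewrite FE; apply/prodf_neq0 => i _.
  have -> : \matrix_(j, l) (\matrix_j sv_map d (X j)) j (ix i l) =
     \matrix_(j, l) X j i 0 (emb i l).
    apply/matrixP => j l; rewrite [LHS]mxE [RHS]mxE [LHS]mxE sv_mapE.
    rewrite (mon_neighbour _ (Hnb _)) /= /coords big1 ?mul1r // => i' _.
    by rewrite X0 expr1n.
  rewrite det_trig ?big1 ?oner_eq0 // => [j _|].
    rewrite !mxE -val_eqE /= val_emb // eqxx andbT -val_eqE /=.
    by case: eqP => _; rewrite ?addr0 ?add0r.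
  apply/is_trig_mxP => j l jl;
    rewrite !mxE (inj_eq (emb_inj n_mono (i := i))) -!val_eqE /= val_emb //.
  by rewrite (gtn_eqF jl) andbF addr0 gtn_eqF // (leq_ltn_trans _ jl).
move=> p Lp nZ.
have ex j : exists t : pt * (forall i, 'I_(n i).+1) * C,
    [/\ forall i, t.1.1 i 0 (t.1.2 i) = 1, t.2 != 0 & row j p = t.2 *: sv_map d t.1.1].
  by have [x [pv [x1 [c c0 pE]]]] := SV_normal (Lp j); exists (x, pv, c).
have [t Ht] := fin_all_exists ex.
have Fp : mx_eval F p != 0.
  apply/eqP => Fp; apply: nZ; split=> // j; have [x1 c0 ->] := Ht j.
  by rewrite scaler_eq0 negb_or c0 (sv_map_neq0 d_gt0 x1).
have [|g [g' [gX gK g'K]]] := @frame (fun j => (t j).1.1).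
  move=> i; move: Fp; rewrite FE => /prodf_neq0/(_ i isT).
  apply: contraNneq => det0.
  (* The factors common to the rows: a singular matrix of coordinates in a factor would make F
     vanish. *)
  pose u : 'rV[C]_(n ord0).+1 := \row_j ((t j).2 *
     \prod_i' (t j).1.1 i' 0 ord0 ^+ (if i' == i then (d i').-1 else d i')).
  have -> : \matrix_(j, l) p j (ix i l) =
      diag_mx u *m \matrix_(j, l) (t j).1.1 i 0 (emb i l).
    apply/matrixP => j l; rewrite mul_diag_mx ![in RHS]mxE [LHS]mxE.
    have [_ _ /rowP/(_ (ix i l))] := Ht j; rewrite [LHS]mxE [RHS]mxE => ->.
    by rewrite sv_mapE (mon_neighbour _ (Hnb _)) /= mulrA.
  by rewrite det_mulmx det0 mulr0.
apply: (@inner_general r n d C d_gt0 n_mono d_gap (fun j => row j p) (fun j => (t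
  j).1.1)
  (fun j => (t j).1.2) (fun j => (t j).2) g g') => // j; by have [] := Ht j.
Qed.

End Main.

Theorem proposition4p6 (R : realType) (r : nat) (n d : 'I_r.+1 -> nat)
    (n_gt0 : forall i, (0 < n i)%N) (d_gt0 : forall i, (0 < d i)%N)
    (n_mono : forall i j : 'I_r.+1, (i <= j)%N -> (n i <= n j)%N)
    (d_ge3 : (3 <= \sum_i d i)%N)
    (d_gap : forall i, i != ord0 -> (d ord0 + 2 <= d i)%N) :
  for_general
    (fun p : 'M[R[i]]_((n ord0).+1, sv_size n d) =>
       forall j, SV n d (row j p))
    (fun p =>
       for_general
         (hyperplanes_through (lin_span (fun w =>
            exists j, osc_space (SV n d) (sv_dim n) (d ord0) (row j p) w)))
         (fun h => ~ tangent_along_pos_dim h (SV n d) (sv_dim n))).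
Proof.
by apply: general_hyperplane => // i; apply: n_mono.
Qed.
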